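(* Let $\{\tilde y_n(x;\theta)\}_{n\in\mathbb{N}_0}$ be one of the following parameter-dependent families of classical orthonormal polynomials, with weight $\omega(x;\theta)$ on $(a,b)$: the orthonormal Laguerre polynomials with parameter $\theta=\alpha$, the orthonormal Jacobi polynomials with parameter $\theta=\alpha$ ($\beta$ fixed), or the orthonormal Jacobi polynomials with parameter $\theta=\beta$ ($\alpha$ fixed). For each $n\in\mathbb{N}_0$ the parameter-based Fisher information $$I_n(\theta)=4\int_a^b\left\{\frac{\partial}{\partial\theta}\Big([\omega(x;\theta)]^{1/2}\,\tilde y_n(x;\theta)\Big)\right\}^2dx$$ has the value $$I_n(\theta)=2\sum_{k=0}^{n-1}\big[\tilde A_k(\theta)\big]^2-2\,\frac{\partial\tilde A_n(\theta)}{\partial\theta},$$ where $\tilde A_k(\theta)$, $k=0,1,\ldots,n$ (which depend also on $n$), are the coefficients of the expansion $$\frac{\partial}{\partial\theta}\tilde y_n(x;\theta)=\sum_{k=0}^n\tilde A_k(\theta)\,\tilde y_k(x;\theta).$$ These coefficients are given by $\tilde A_k(\theta)=\frac{d_k(\theta)}{d_n(\theta)}A_k(\theta)$ for $0\le k\le n-1$ and $\tilde A_n(\theta)=A_n(\theta)-\frac{1}{d_n(\theta)}\frac{\partial d_n(\theta)}{\partial\theta}$, where $y_m(x;\theta)$ are the corresponding standard (non-normalized) Laguerre or Jacobi polynomials, $d_m(\theta)>0$ is the norm of $y_m(x;\theta)$, and $A_k(\theta)$ are the coefficients in $\frac{\partial}{\partial\theta}y_n(x;\theta)=\sum_{k=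0}^nA_k(\theta)y_k(x;\theta)$.
   Context: Laguerre: $y_n=L_n^{(\alpha)}(x)$, weight $\omega(x;\alpha)=e^{-x}x^{\alpha}$ on $(0,\infty)$, $\alpha>-1$, with $d_k^2=\frac{\Gamma(k+\alpha+1)}{k!}$. Jacobi: $y_n=P_n^{(\alpha,\beta)}(x)$ (standard normalization), weight $\omega=(1-x)^{\alpha}(1+x)^{\beta}$ on $(-1,1)$, $\alpha,\beta>-1$, with $d_k^2=\frac{2^{\alpha+\beta+1}\Gamma(k+\alpha+1)\Gamma(k+\beta+1)}{k!(2k+\alpha+\beta+1)\Gamma(k+\alpha+\beta+1)}$. The orthonormal polynomials are $\tilde y_n=y_n/d_n$, so that $\int_a^b\tilde y_n\tilde y_m\,\omega\,dx=\delta_{nm}$ and $\deg\tilde y_n=n$. The Rakhmanov density is $\tilde\rho_n(x;\theta)=\omega(x;\theta)\tilde y_n^2(x;\theta)$; $I_n(\theta)$ is its Fisher information with respect to $\theta$, with the convention $[\tilde\rho_n]^{1/2}=\omega^{1/2}\tilde y_n$. Explicit values of the coefficients, with $\psi=\Gamma'/\Gamma$ and $(x)_m$ the Pochhammer symbol (expressions that are formally indeterminate at $\alpha+\beta+1=0$ are understood by continuity): Laguerre: $\tilde A_k=\frac{1}{n-k}\left[\frac{(k+1)_{n-k}}{(k+\alpha+1)_{n-k}}\right]^{1/2}$ for $k<n$, and $\tilde A_n=-\frac12\psi(n+\alpha+1)$. Jacobi, $\theta=\alpha$: $\tilde A_k=\left[\frac{(k+\beta+1)_{n-k}(k+1)_{n-k}}{(k+\alpha+1)_{n-k}(k+\alpha+\beta+1)_{n-k}}\frac{2n+\alpha+\beta+1}{2k+\alpha+\beta+1}\right]^{1/2}\frac{2k+\alpha+\beta+1}{(n-k)(n+k+\alpha+\beta+1)}$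 for $k<n$, and $\tilde A_n=\frac12\left[2\psi(2n+\alpha+\beta+1)-\psi(n+\alpha+\beta+1)-\psi(n+\alpha+1)-\ln2+\frac{1}{2n+\alpha+\beta+1}\right]$. Jacobi, $\theta=\beta$: the same formulas with $\alpha$ and $\beta$ interchanged, and with an additional factor $(-1)^{n-k}$ in $\tilde A_k$ for $k<n$. *)

(* Defs.v *)
(* MathComp-Analysis; R : realType throughout. *)
From HB Require Import structures.
From mathcomp Require Import all_boot all_order all_algebra.
From mathcomp Require Import all_classical all_reals all_analysis.

Set Implicit Arguments.
Unset Strict Implicit.
Unset Printing Implicit Defensive.

Import Order.TTheory GRing.Theory Num.Theory.
Import numFieldNormedType.Exports.

Local Open Scope classical_set_scope.
Local Open Scope ring_scope.

(* Generalized binomial coefficient a (a - 1) ... (a - m + 1) / m!, a real. *)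
Definition gbinom (R : realType) (a : R) (m : nat) : R :=
  (\prod_(i < m) (a - i%:R)) / (m`!)%:R.

(* L_n^(a) = sum_i (-1)^i binom(n + a, n - i) X^i / i! *)
Definition laguerre (R : realType) (a : R) (n : nat) : {poly R} :=
  \sum_(i < n.+1)
    ((-1) ^+ i * gbinom (n%:R + a) (n - i) / (i`!)%:R) *: 'X^i.

(* P_n^(a,b) = sum_s binom(n + a, n - s) binom(n + b, s)
                 ((X - 1) / 2)^s ((X + 1) / 2)^(n - s);
   a polynomial in a and b too, and P_n^(a,b)(1) = binom(n + a, n). *)
Definition jacobi (R : realType) (a b : R) (n : nat) : {poly R} :=
  \sum_(s < n.+1)
    (gbinom (n%:R + a) (n - s) * gbinom (n%:R + b) s / 2 ^+ n)
      *: (('X - 1) ^+ s * ('X + 1) ^+ (n - s)).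

(* A family of polynomials depending on a real parameter t, with its weight. *)
Record param_family (R : realType) := ParamFamily {
  param : set R;                  (* admissible values of the parameter *)
  supp_itv : set R;               (* the interval (a, b) *)
  weight : R -> R -> R;           (* weight t x *)
  stdpoly : R -> nat -> {poly R}  (* stdpoly t n, standard normalization *)
}.

Section Families.
Variable R : realType.

Definition laguerre_family : param_family R :=
  {| param := [set t | -1 < t];
     supp_itv := `]0, +oo[;
     weight := fun t x => expR (- x) * x `^ t;
     stdpoly := fun t n => laguerre t n |}.

Definition jacobi_alpha_family (b : R) : param_family R :=
  {| param := [set t | -1 < t];
     supp_itv := `]-1, 1[;
     weight := fun t x => (1 - x) `^ t * (1 + x) `^ b;
     stdpoly := fun t n => jacobi t b n |}.

Definition jacobi_beta_family (a : R) : param_family R :=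
  {| param := [set t | -1 < t];
     supp_itv := `]-1, 1[;
     weight := fun t x => (1 - x) `^ a * (1 + x) `^ t;
     stdpoly := fun t n => jacobi a t n |}.

Inductive classical_family : param_family R -> Prop :=
| Laguerre : classical_family laguerre_family
| JacobiAlpha b : -1 < b -> classical_family (jacobi_alpha_family b)
| JacobiBeta a : -1 < a -> classical_family (jacobi_beta_family a).

End Families.

Section FisherInformation.
Variables (R : realType) (F : param_family R).

Definition wnorm (n : nat) (t : R) : R :=
  Num.sqrt (\int[lebesgue_measure]_(x in supp_itv F)
              (weight F t x * (stdpoly F t n).[x] ^+ 2)).

Definition orthopoly (t : R) (n : nat) : {poly R} :=
  (wnorm n t)^-1 *: stdpoly F t n.

(* The square root of the Rakhmanov density, with the sign of the polynomial. *)
Definition root_density (n : nat) (t x : R) : R :=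
  Num.sqrt (weight F t x) * (orthopoly t n).[x].

(* Extended-real valued, so that a divergent integral is not silently 0. *)
Definition fisher_information (n : nat) (t : R) : \bar R :=
  (4%R%:E * \int[lebesgue_measure]_(x in supp_itv F)
            (derive1 (fun s => root_density n s x) t ^+ 2)%R%:E)%E.

(* d/dt p_n(x; t) exists and equals sum_(k <= n) c_k(t) p_k(x; t), for every
   admissible t and every x; the c_k with k > n are irrelevant. *)
Definition param_derive_expansion (p : R -> nat -> {poly R}) (n : nat)
    (c : nat -> R -> R) : Prop :=
  forall t, param F t -> forall x : R,
    is_derive t 1 (fun s => (p s n).[x]) (\sum_(k < n.+1) c k t * (p t k).[x]).

End FisherInformation.

(* Main.v *)
(* Let [p_k] be the orthonormal polynomials and write the weight as
   [w0 * exp (t * L)].  Expanding [d p_n/dt] on the [p_k] and differentiating the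
   orthonormality relations [<p_n, p_k> = delta] once gives
     [<L p_n, p_k> = - At_k] for [k < n]  and  [<L p_n, p_n> = - 2 At_n];
   differentiating the last relation again gives
     [<L^2 p_n, p_n> + 2 <L p_n, d p_n/dt> = - 2 d At_n/dt].
   The Fisher information is [<L^2 p_n, p_n> + 4 <L p_n, d p_n/dt>
   + 4 |d p_n/dt|^2], and substituting these relations yields the formula.
   Orthogonality of the explicit polynomials reduces, through the recurrences of
   the Gamma and Beta integrals (one integration by parts), to the vanishing of
   the [n]-th finite difference of a polynomial of degree less than [n]. *)
Require Import Defs.
From mathcomp Require Import all_boot all_order all_algebra.
From mathcomp Require Import all_classical all_reals all_analysis.
From mathcomp Require Import measurable_realfun ring lra.
Set Implicit Arguments.
Unset Strict Implicit.
Unset Printing Implicit Defensive.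
Import Order.TTheory GRing.Theory Num.Theory.
Import numFieldNormedType.Exports.
Local Open Scope classical_set_scope.
Local Open Scope ring_scope.

(** The analytic obstacle is differentiating twice under the integral sign: each differentiation
    inserts a factor [L], which is unbounded near an endpoint. Any power of [L] is absorbed by
    moving the parameter slightly, so integrability of polynomials against the bare weight, for
    every parameter above -1, gives all the integrability and domination required. Everything else
    happens among polynomials of bounded degree and is finite-dimensional linear algebra. Norms and
    expansion coefficients are never evaluated. Moments of the weight are only compared with one
    another, and their ratios are made to cancel against the factors of the generalized
    binomials. *)

(** * Zeros of polynomials and differentiable curves of polynomials *)

Lemma horner0_eq0 (R : numDomainType) (p : {poly R}) :
  (forall x, p.[x] = 0) -> p = 0.
Proof.
move=> p0; apply/eqP; apply/negPn/negP => pn0.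
have := @max_poly_roots _ p [seq i%:R | i <- iota 0 (size p)] pn0.
rewrite size_map size_iota ltnn => /(_ _ _)/negP; apply=> //.
- by apply/allP => x _; rewrite rootE p0.
- by rewrite map_inj_uniq ?iota_uniq// => i j /eqP; rewrite eqr_nat => /eqP.
Qed.

Lemma finite_root (R : idomainType) (p : {poly R}) :
  p != 0 -> finite_set [set x | root p x].
Proof.
have [n] := ubnP (size p); elim: n p => // n IHn p; rewrite ltnS => pn p0.
have [[a ra]|noroot] := pselect (exists a, root p a); last first.
  rewrite (_ : [set _ | _] = set0); first exact: finite_set0.
  by apply/seteqP; split => // x rx; apply: noroot; exists x.
have /factor_theorem[q pE] := ra.
have q0 : q != 0 by apply: contra_neq p0 => q0; rewrite pE q0 mul0r.
apply: (@sub_finite_set _ _ ([set a] `|` [set x | root q x])).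
  move=> x /=; rewrite pE rootM root_XsubC => /orP[?|/eqP->]; by [right|left].
rewrite finite_setU; split; first exact: finite_set1.
apply: IHn => //; apply: leq_trans pn.
by rewrite pE size_Mmonic ?monicXsubC// size_XsubC addn2.
Qed.

Lemma poly_wideE (R : nzRingType) (N : nat) (q : {poly R}) :
  (size q <= N)%N -> q = \sum_(i < N) q`_i *: 'X^i.
Proof.
move=> sq; rewrite -poly_def; apply/polyP => i; rewrite coef_poly.
by case: ltnP => // Ni; rewrite nth_default// (leq_trans sq).
Qed.

(* Coefficientwise derivative, in the parameter, of a curve of polynomials. *)
Definition is_poly_derive (R : realType) (t : R) (Q : R -> {poly R})
    (dQ : {poly R}) :=
  forall i, is_derive t 1 (fun s => (Q s)`_i) dQ`_i.

Section PolyCurve.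
Context {R : realType}.
Implicit Types (t : R) (P Q : R -> {poly R}) (dP dQ : {poly R}).

(** The degree bound is uniform in the parameter, so evaluation at [x] is one finite sum of fixed
    length along the whole curve. *)
Lemma is_poly_derive_horner t (N : nat) Q dQ x :
  (forall s, (size (Q s) <= N)%N) -> (size dQ <= N)%N ->
  is_poly_derive t Q dQ -> is_derive t 1 (fun s => (Q s).[x]) dQ.[x].
Proof.
move=> sQ sdQ dc.
rewrite (_ : (fun s => _) = \sum_(i < N) (fun s => (Q s)`_i * x ^+ i)); last first.
  by apply/funext => s; rewrite fct_sumE (horner_coef_wide _ (sQ s)).
rewrite (horner_coef_wide _ sdQ); apply: is_derive_sum => i.
have d1 := dc i; apply: is_derive_eq.
by rewrite /GRing.scale/=; ring.
Qed.

Lemma is_poly_deriveM t P dP Q dQ :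
  is_poly_derive t P dP -> is_poly_derive t Q dQ ->
  is_poly_derive t (fun s => P s * Q s) (dP * Q t + P t * dQ).
Proof.
move=> HP HQ i; rewrite coefD !coefM -big_split/=.
rewrite (_ : (fun s => _) =
    \sum_(j < i.+1) (fun s => (P s)`_j * (Q s)`_(i - j))); last first.
  by apply/funext => s; rewrite fct_sumE coefM.
apply: is_derive_sum => j.
have d1 := HP j; have d2 := HQ (i - j)%N; apply: is_derive_eq.
by rewrite /GRing.scale/=; ring.
Qed.

Lemma is_poly_deriveZ t (c : R -> R) dc Q dQ :
  is_derive t 1 c dc -> is_poly_derive t Q dQ ->
  is_poly_derive t (fun s => c s *: Q s) (dc *: Q t + c t *: dQ).
Proof.
move=> Hc HQ i; rewrite coefD !coefZ.
under eq_fun do rewrite coefZ.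
have d1 := HQ i; apply: is_derive_eq.
by rewrite /GRing.scale/=; ring.
Qed.

End PolyCurve.

(** * Improper integrals by exhaustion *)

Section ExhaustionFTC.
Context {R : realType}.
Notation mu := (@lebesgue_measure R).
Variables (D : set R) (l r : nat -> R) (f F : R -> R).
Hypothesis l_lt_r : forall n, l n < r n.
Hypothesis l_ni : nonincreasing_seq l.
Hypothesis r_nd : nondecreasing_seq r.
Hypothesis DE : D = \bigcup_n [set` `[l n, r n]].
Hypothesis dF : forall x, D x -> is_derive x 1 F (f x).
Hypothesis cf : forall x, D x -> {for x, continuous f}.

Let sD n : [set` `[l n, r n]] `<=` D.
Proof. by rewrite DE => x ?; exists n. Qed.

Let integral_segment n :
  (\int[mu]_(x in `[l n, r n]) (f x)%:E = (F (r n) - F (l n))%:E)%E.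
Proof.
have cF x : D x -> {for x, continuous F}.
  move=> /dF [dFx _].
  by apply/differentiable_continuous/derivable1_diffP.
have lD : D (l n) by apply: (@sD n); rewrite /= in_itv/= lexx ltW.
have rD : D (r n) by apply: (@sD n); rewrite /= in_itv/= lexx ltW.
rewrite (@continuous_FTC2 _ f F) ?EFinB//.
- apply: continuous_in_subspaceT => x /set_mem xlr.
  exact/cf/(@sD n).
- split.
  + move=> x /subset_itv_oo_cc xlr.
    by have [] := dF (sD xlr).
  + exact/cvg_at_right_filter/cF.
  + exact/cvg_at_left_filter/cF.
- move=> x /subset_itv_oo_cc xlr.
  have := dF (sD xlr) => dFx.
  by rewrite derive1E; case: dFx.
Qed.

Let mf n : measurable_fun `[l n, r n] f.
Proof.
apply: subspace_continuous_measurable_fun => //.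
by apply: continuous_in_subspaceT => x /set_mem xlr; exact/cf/(@sD n).
Qed.

Let nd_itv : nondecreasing_seq (fun n => `[l n, r n]%classic : set R).
Proof.
move=> m n mn; apply/subsetPset => x /=; rewrite !in_itv/= => /andP[lx xr].
by rewrite (le_trans (l_ni mn) lx) (le_trans xr (r_nd mn)).
Qed.

Lemma measurable_fun_exhaustion : measurable_fun D f.
Proof. by rewrite DE; apply/measurable_fun_bigcup => // n; exact: mf. Qed.

(** For a nonnegative integrand, monotone convergence turns a uniform bound on the increments of a
    primitive into integrability; no limit of the primitive is needed. *)
Lemma integrable_exhaustion (K : R) :
  (forall x, D x -> 0 <= f x) -> (forall n, F (r n) - F (l n) <= K) ->
  mu.-integrable D (EFin \o f).
Proof.
move=> f0 FK; apply/integrableP; split.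
  apply/measurable_EFinP. exact: measurable_fun_exhaustion.
have -> : (\int[mu]_(x in D) `|(EFin \o f) x| = \int[mu]_(x in D) (f x)%:E)%E.
  by apply: eq_integral => x /set_mem Dx /=; rewrite ger0_norm ?f0.
apply: (@le_lt_trans _ _ K%:E); last exact: ltry.
have := @ge0_nondecreasing_set_cvg_integral _ (measurableTypeR R) R _
  (EFin \o f) lebesgue_measure nd_itv.
rewrite -DE => /(_ _ _ _)/cvg_lim <- //; last first.
- by move=> n x /sD /f0; rewrite /= lee_fin.
- by move=> n; apply/measurable_EFinP; exact: mf.
apply: lime_le; last by apply: nearW => n; rewrite integral_segment lee_fin.
apply: ereal_nondecreasing_is_cvgn.
apply: ge0_nondecreasing_set_nondecreasing_integral => //.
- by move=> n; apply/measurable_EFinP; exact: mf.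
- by move=> n x /sD /f0; rewrite /= lee_fin.
Qed.

(** The integrand may change sign here, so the passage to the limit is by dominated convergence,
    with the absolute value of the integrand as its own majorant. With [L = 0] this is integration
    by parts with vanishing boundary terms. *)
Lemma Rintegral_exhaustion (L : R) :
  mu.-integrable D (EFin \o f) -> F (r n) - F (l n) @[n --> \oo] --> L ->
  \int[mu]_(x in D) f x = L.
Proof.
move=> fi FL.
have mD : measurable D by rewrite DE; apply: bigcup_measurable => n _.
pose g n := (EFin \o f) \_ `[l n, r n].
have mfD := measurable_int _ fi.
have [] := @dominated_convergence _ (measurableTypeR R) R lebesgue_measure
  D mD g (EFin \o f) (abse \o (EFin \o f)).
- move=> n; apply/(measurable_restrict _ _ _) => //.
  by apply: measurable_funS mfD => // x [].
- exact: mfD.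
- apply: aeW => x; rewrite [in D x]DE => -[N _ xN].
  apply: cvg_near_cst; near=> n.
  rewrite /g patchE mem_set//.
  have /nd_itv/subsetPset : (N <= n)%N by near: n; exact: nbhs_infty_ge.
  by apply.
- exact: integrable_abse.
- apply: aeW => x n Dx; rewrite /g patchE; case: ifPn => //=.
  by rewrite normr0 lee_fin.
move=> _ _ cvg.
rewrite /Rintegral; suff -> : (\int[mu]_(x in D) (f x)%:E)%E = L%:E by [].
apply: (cvg_unique _ cvg) => //.
rewrite (_ : (fun _ => _) = EFin \o (fun n => F (r n) - F (l n))).
  by apply: cvg_EFin => //; exact: nearW.
apply/funext => n /=; rewrite -integral_segment.
rewrite -integral_mkcondr.
by congr (integral _ _ _); apply/setIidr/sD.
Unshelve. all: by end_near. Qed.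

End ExhaustionFTC.

(** * Orthogonal polynomials for an exponential family of weights *)

(** Since (e|y|)^j / j! is at most exp(e|y|), the power costs one factor exp(e|y|) and the constant
    [j! / e^j]; replacing [s] by [t] costs another. Hence the shift [2 * e], and two exponentials to
    cover both signs of [y]. *)
Lemma norm_exprM_expR_le (R : realType) (j : nat) (t e : R) : 0 < e ->
  exists2 K : R, 0 <= K & forall s y : R, `|s - t| <= e ->
    `|y ^+ j * expR (s * y)| <=
      K * (expR ((t + 2 * e) * y) + expR ((t - 2 * e) * y)).
Proof.
move=> e0; exists (j`!%:R / e ^+ j).
  by rewrite divr_ge0 ?exprn_ge0 ?ltW ?ler0n.
move=> s y st.
have pow : `|y| ^+ j <= j`!%:R / e ^+ j * expR (e * `|y|).
  rewrite mulrAC ler_pdivlMr ?exprn_gt0// mulrC -exprMn.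
  rewrite [X in _ <= X]mulrC -ler_pdivrMr ?ltr0n ?fact_gt0//.
  have ey : 0 <= e * `|y| by rewrite mulr_ge0// ltW.
  case: j => [|j]; first by rewrite expr0 fact0 mulr1n divr1 -expR0 ler_expR.
  by apply: le_trans (expR_ge1Dxn j ey); rewrite lerDr ler01.
have expb : expR (s * y) <= expR (t * y + e * `|y|).
  rewrite ler_expR -lerBlDl -mulrBl.
  by rewrite (le_trans (ler_norm _))// normrM ler_wpM2r.
have expc : expR (t * y + 2 * (e * `|y|)) <=
    expR ((t + 2 * e) * y) + expR ((t - 2 * e) * y).
  have [y0|y0] := leP 0 y.
    by rewrite ger0_norm// mulrA -mulrDl lerDl expR_ge0.
  by rewrite ltr0_norm// !mulrN mulrA -mulrBl lerDr expR_ge0.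
rewrite normrM normrX (ger0_norm (expR_ge0 _)).
apply: (@le_trans _ _ (j`!%:R / e ^+ j * expR (e * `|y|)
    * expR (t * y + e * `|y|))).
  by apply: ler_pM; rewrite ?exprn_ge0 ?expR_ge0.
rewrite -mulrA -expRD ler_wpM2l//.
  by rewrite divr_ge0 ?ler0n// exprn_ge0// ltW.
by rewrite (_ : e * _ + _ = t * y + 2 * (e * `|y|)) //; ring.
Qed.

Section ExponentialWeight.
Context {R : realType}.
Notation mu := (@lebesgue_measure R).
Variables (D : set R) (w0 L : R -> R).
Hypothesis mD : @measurable _ (measurableTypeR R) D.
Hypothesis mw0 : @measurable_fun _ _ (measurableTypeR R) R D w0.
Hypothesis mL : @measurable_fun _ _ (measurableTypeR R) R D L.

(* Each of the three weights is [w0 x * expR (t * L x)] with [L] the logarithm of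
   [x], [1 - x] or [1 + x], so the [j]-th parameter derivative of the weight
   just inserts the factor [L x ^+ j]. *)
Definition weighted (j : nat) (t : R) (q : {poly R}) (x : R) : R :=
  L x ^+ j * (w0 x * expR (t * L x) * q.[x]).

Definition wint (j : nat) (t : R) (q : {poly R}) : R :=
  \int[mu]_(x in D) weighted j t q x.

Hypothesis wint_fin : forall (t : R) q, -1 < t ->
  mu.-integrable D (EFin \o weighted 0 t q).

Lemma measurable_weighted j t q :
  @measurable_fun _ _ (measurableTypeR R) R D (weighted j t q).
Proof.
apply: measurable_funM; first exact: measurable_funX.
apply: measurable_funM; last exact: measurable_poly.
apply: measurable_funM => //.
apply: (measurableT_comp (@measurable_expR R)).
exact: measurable_funM.
Qed.

(** One majorant serves all parameters near [t], whatever the power of [L]. The bound on [e] keeps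
    [t - 2 * e] above -1, where [wint_fin] applies. *)
Let dominating j (t e : R) q : 0 < e -> 2 * e < t + 1 ->
  exists G : R -> R, [/\ forall x, 0 <= G x,
    mu.-integrable D (EFin \o G) &
    forall s x, `|s - t| <= e -> D x -> `|weighted j s q x| <= G x].
Proof.
move=> e0 et; have [K K0 HK] := norm_exprM_expR_le j t e0.
exists (fun x => K *
  (`|weighted 0 (t + 2 * e) q x| + `|weighted 0 (t - 2 * e) q x|)); split.
- by move=> x; rewrite mulr_ge0// addr_ge0.
- apply: (@integrableZl _ (measurableTypeR R) R lebesgue_measure D mD K
    (fun x => (`|weighted 0 (t + 2 * e) q x| + `|weighted 0 (t - 2 * e) q x|)%:E)).
  under eq_fun do rewrite EFinD.
  by apply: integrableD => //; apply: integrable_norm => //;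
    apply: wint_fin; lra.
- move=> s x st Dx; rewrite /weighted !expr0 !mul1r.
  rewrite (_ : _ * _ = L x ^+ j * expR (s * L x) * (w0 x * q.[x])); last by ring.
  rewrite normrM; apply: (le_trans (ler_wpM2r _ (HK s (L x) st))) => //.
  rewrite -[X in X <= _]mulrA ler_wpM2l// mulrDl !normrM !(ger0_norm (expR_ge0 _)).
  by rewrite le_eqVlt; apply/orP; left; apply/eqP; ring.
Qed.

Lemma integrable_weighted j (t : R) q : -1 < t ->
  mu.-integrable D (EFin \o weighted j t q).
Proof.
move=> t1.
have [||G [G0 iG HG]] := @dominating j t ((t + 1) / 4) q; [lra|lra|].
apply: le_integrable iG => //.
  by apply/measurable_EFinP; exact: measurable_weighted.
move=> x Dx /=; rewrite lee_fin (ger0_norm (G0 x)).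
by apply: HG => //; rewrite subrr normr0; lra.
Qed.

Let is_derive_weighted j q x (s : R) :
  is_derive s 1 (fun t => weighted j t q x) (weighted j.+1 s q x).
Proof.
apply: is_derive_eq; rewrite /= /weighted.
rewrite !(scaler0,addr0,add0r,mulr1,mulr0,scaler1)/GRing.scale/=.
by rewrite exprS; ring.
Qed.

Lemma is_derive_wint_poly j q (t : R) : -1 < t ->
  is_derive t 1 (fun s => wint j s q) (wint j.+1 t q).
Proof.
move=> t1; pose e : R := (t + 1) / 4.
have [||G [G0 iG HG]] := @dominating j.+1 t e q; rewrite /e; [lra|lra|].
have It : `]t - e, t + e[%classic t by rewrite /= in_itv/= /e; apply/andP; split; lra.
have dE x s : partial1of2 (fun s => weighted j s q) s x = weighted j.+1 s q x.
  by rewrite partial1of2E; have [_ ->] := is_derive_weighted j q x s.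
have h1 (s : R) : `]t - e, t + e[%classic s -> mu.-integrable D (EFin \o weighted j s q).
  rewrite /= in_itv/= => /andP[s1 _]; apply: integrable_weighted.
  by have {}s1 : t - (t + 1) / 4 < s := s1; lra.
have h2 (s : R) x : `]t - e, t + e[%classic s -> D x ->
    derivable (fun s => weighted j s q x) s 1.
  by have [] := is_derive_weighted j q x s.
have h3 (s : R) x : `]t - e, t + e[%classic s -> D x ->
    `|partial1of2 (fun s => weighted j s q) s x| <= G x.
  rewrite /= in_itv/= => /andP[s1 s2] Dx; rewrite dE; apply: HG => //.
  have {}s1 : t - e < s := s1; have {}s2 : s < t + e := s2.
  by rewrite ler_norml; apply/andP; split; rewrite /e in s1 s2 *; lra.
apply: DeriveDef.
  exact: (@derivable_under_integral R _ (measurableTypeR R) lebesgue_measure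
    (fun s => weighted j s q) D mD t (t - e) (t + e) It h1 h2 G G0 iG h3).
rewrite -derive1E.
rewrite (@differentiation_under_integral R _ (measurableTypeR R) lebesgue_measure
    (fun s => weighted j s q) D mD t (t - e) (t + e) It h1 h2 G G0 iG h3).
by apply: eq_Rintegral => x _; rewrite dE.
Qed.

Lemma wintD j (t : R) p q : -1 < t -> wint j t (p + q) = wint j t p + wint j t q.
Proof.
move=> t1; rewrite /wint -RintegralD//; try exact: integrable_weighted.
by apply: eq_Rintegral => x _; rewrite /weighted hornerD; ring.
Qed.

Lemma wintZ j (t : R) c q : -1 < t -> wint j t (c *: q) = c * wint j t q.
Proof.
move=> t1; rewrite /wint -RintegralZl//; try exact: integrable_weighted.
by apply: eq_Rintegral => x _; rewrite /weighted hornerZ; ring.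
Qed.

Lemma wint0 j t : wint j t 0 = 0.
Proof.
rewrite /wint (@eq_Rintegral _ _ _ _ _ (cst 0)) ?Rintegral_cst ?mul0r//.
by move=> x _; rewrite /weighted horner0 !mulr0.
Qed.

Lemma wint_sum j (t : R) (I : Type) (r : seq I) (P : pred I) (q : I -> {poly R}) :
  -1 < t -> wint j t (\sum_(i <- r | P i) q i) = \sum_(i <- r | P i) wint j t (q i).
Proof.
move=> t1; elim/big_rec2: _ => [|i y1 y2 _ <-]; first exact: wint0.
by rewrite wintD.
Qed.

Lemma near_gtN1 (t : R) : -1 < t -> \forall s \near t, -1 < s.
Proof. by move=> ?; near=> s; near: s; exact: lt_nbhsr. Unshelve. all: by end_near. Qed.

(** Weight and polynomial both move with the parameter. Splitting into a fixed number of monomials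
    separates them: each term is a coefficient times a moment. The splitting uses linearity of the
    integral, hence parameters above -1, so it is only an identity near [t]. *)
Lemma is_derive_wint j N (Q : R -> {poly R}) (dQ : {poly R}) (t : R) : -1 < t ->
  (forall s, (size (Q s) <= N)%N) -> (size dQ <= N)%N ->
  (forall i, is_derive t 1 (fun s => (Q s)`_i) dQ`_i) ->
  is_derive t 1 (fun s => wint j s (Q s)) (wint j.+1 t (Q t) + wint j t dQ).
Proof.
move=> t1 sQ sdQ dc.
have wintE k (s : R) (q : {poly R}) : -1 < s -> (size q <= N)%N ->
    wint k s q = \sum_(i < N) q`_i * wint k s 'X^i.
  move=> s1 sq; rewrite {1}(poly_wideE sq) wint_sum//.
  by apply: eq_bigr => i _; rewrite wintZ.
apply: (@near_eq_is_derive _ _ _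
  (\sum_(i < N) (fun s => (Q s)`_i * wint j s 'X^i))).
  near=> s; rewrite fct_sumE wintE//.
  by near: s; exact: near_gtN1.
rewrite !wintE// -big_split/=.
apply: is_derive_sum => i.
have d1 := dc i; have d2 := is_derive_wint_poly j 'X^i t1.
apply: is_derive_eq; rewrite /GRing.scale/=; ring.
Unshelve. all: by end_near. Qed.


(** * Positive definiteness of the weighted inner product *)

Hypothesis w0_gt0 : forall x, D x -> 0 < w0 x.
Hypothesis D_gt0 : (0 < mu D)%E.

Lemma weighted_sqr_ge0 t q x : D x -> 0 <= weighted 0 t (q * q) x.
Proof.
move=> Dx; rewrite /weighted expr0 mul1r hornerM -expr2.
by rewrite mulr_ge0 ?sqr_ge0// mulr_ge0 ?expR_ge0// ltW// w0_gt0.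
Qed.

(** A nonnegative integrand with zero integral vanishes almost everywhere. As the weight is
    positive, [D] would be covered by a null set and the finitely many roots of [q], against
    [D_gt0]. *)
Lemma wint_sqr_gt0 (t : R) q : -1 < t -> q != 0 -> 0 < wint 0 t (q * q).
Proof.
move=> t1 q0; rewrite lt_neqAle Rintegral_ge0 ?andbT; last first.
  by move=> x Dx; exact: weighted_sqr_ge0.
apply/negP => /eqP/esym I0.
have iq := @integrable_weighted 0 t (q * q) t1.
have : (\int[mu]_(x in D) `|(weighted 0 t (q * q) x)%:E| = 0)%E.
  rewrite (_ : (\int[mu]_(x in D) `|(weighted 0 t (q * q) x)%:E|)%E =
     \int[mu]_(x in D) (weighted 0 t (q * q) x)%:E)%E; last first.
    apply: eq_integral => x /set_mem Dx /=.
    by rewrite ger0_norm// weighted_sqr_ge0.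
  have := integrable_fin_num mD iq.
  move=> /fineK <-; congr EFin; exact: I0.
have mq := measurable_int _ iq.
move=> /(ae_eq_integral_abs lebesgue_measure mD mq)[N [mN N0 sN]].
have mroot : (@measurable _ (measurableTypeR R)) [set x | root q x].
  apply: countable_measurable; first by move=> x; exact: measurable_set1.
  by apply: finite_set_countable; exact: finite_root.
have : (mu D <= mu (N `|` [set x | root q x]))%E.
  rewrite le_measure ?inE//; first exact: measurableU.
  move=> x Dx; have [rx|rx] := boolP (root q x); [by right|left].
  apply: sN => /= /(_ Dx)[] /eqP.
  rewrite /weighted expr0 mul1r hornerM mulf_eq0 (mulf_eq0 (w0 x)) mulf_eq0.
  rewrite gt_eqF ?w0_gt0// gt_eqF ?expR_gt0//= orbb => qx0.
  by move: rx; rewrite rootE qx0.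
rewrite leNgt => /negP; apply; apply: le_lt_trans D_gt0.
apply: (le_trans (measureU2 _ _ _)) => //.
rewrite [X in (X + _)%E]N0 add0e [X in (X <= _)%E]countable_lebesgue_measure0//.
by apply: finite_set_countable; exact: finite_root.
Qed.

(** * Orthonormal polynomials and their parameter derivatives *)

Variable F : param_family R.
Hypothesis paramE : param F = [set t | -1 < t].
Hypothesis suppE : supp_itv F = D.
Hypothesis weightE : forall t x, D x -> weight F t x = w0 x * expR (t * L x).
Notation y := (stdpoly F).
Hypothesis size_y : forall t n, (size (y t n) <= n.+1)%N.
Hypothesis y_neq0 : forall (t : R) n, -1 < t -> y t n != 0.
Hypothesis derivable_y : forall (t : R) n i, derivable (fun s => (y s n)`_i) t 1.
Hypothesis y_orth : forall (t : R) n (q : {poly R}), -1 < t -> (size q <= n)%N ->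
  wint 0 t (y t n * q) = 0.

Notation d := (wnorm F).
Notation p := (orthopoly F).

Lemma wnormE n t : d n t = Num.sqrt (wint 0 t (y t n * y t n)).
Proof.
rewrite /wnorm suppE; congr Num.sqrt; apply: eq_Rintegral => x /set_mem Dx.
by rewrite weightE// /weighted expr0 mul1r hornerM expr2.
Qed.

Lemma wnorm_gt0 n (t : R) : -1 < t -> 0 < d n t.
Proof. by move=> t1; rewrite wnormE sqrtr_gt0 wint_sqr_gt0// y_neq0. Qed.

Lemma wnorm_sqr n (t : R) : -1 < t -> d n t ^+ 2 = wint 0 t (y t n * y t n).
Proof. by move=> t1; rewrite wnormE sqr_sqrtr// ltW// wint_sqr_gt0// y_neq0. Qed.

Lemma stdpolyE n (t : R) : -1 < t -> y t n = d n t *: p t n.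
Proof.
by move=> t1; rewrite /orthopoly scalerA divff ?scale1r// gt_eqF// wnorm_gt0.
Qed.

Lemma size_orthopoly_le t n : (size (p t n) <= n.+1)%N.
Proof. exact: leq_trans (size_scale_leq _ _) (size_y t n). Qed.

Lemma orthopoly_orth (t : R) n (q : {poly R}) : -1 < t -> (size q <= n)%N ->
  wint 0 t (p t n * q) = 0.
Proof. by move=> t1 sq; rewrite -scalerAl wintZ// y_orth// mulr0. Qed.

Lemma orthopoly_neq0 (t : R) n : -1 < t -> p t n != 0.
Proof.
by move=> t1; rewrite scaler_eq0 negb_or invr_eq0 y_neq0// gt_eqF ?wnorm_gt0.
Qed.

(** A polynomial of smaller degree would be orthogonal to itself. Exact degrees thus follow from
    positivity, without computing leading coefficients. *)
Lemma size_orthopoly (t : R) n : -1 < t -> size (p t n) = n.+1.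
Proof.
move=> t1; apply/eqP; rewrite eqn_leq size_orthopoly_le ltnNge; apply/negP => sp.
have := wint_sqr_gt0 t1 (orthopoly_neq0 n t1).
by rewrite orthopoly_orth// ltxx.
Qed.

Lemma orthonormal (t : R) n m : -1 < t -> wint 0 t (p t n * p t m) = (n == m)%:R.
Proof.
move=> t1; have [<-|] := eqVneq n m; last first.
  rewrite neq_ltn => /orP[nm|mn]; first rewrite mulrC.
    by rewrite orthopoly_orth// size_orthopoly.
  by rewrite orthopoly_orth// size_orthopoly.
rewrite /orthopoly -scalerAl -scalerAr scalerA wintZ// -wnorm_sqr//.
by rewrite -invfM mulVf// mulf_neq0// gt_eqF// wnorm_gt0.
Qed.

Lemma wint_orthosum (t : R) N (a : 'I_N -> R) (j : 'I_N) : -1 < t ->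
  wint 0 t ((\sum_(k < N) a k *: p t k) * p t j) = a j.
Proof.
move=> t1; rewrite mulr_suml wint_sum// (bigD1 j)//= big1 => [|k kj].
  by rewrite -scalerAl wintZ// orthonormal// eqxx mulr1 addr0.
by rewrite -scalerAl wintZ// orthonormal// (inj_eq val_inj) (negbTE kj) mulr0.
Qed.

Lemma orthopoly_expansion (t : R) N (q : {poly R}) : -1 < t -> (size q <= N)%N ->
  q = \sum_(k < N) wint 0 t (q * p t k) *: p t k.
Proof.
move=> t1; elim: N q => [|N IHN] q sq.
  by rewrite big_ord0; apply/eqP; rewrite -size_poly_eq0 -leqn0.
(* This [c] cancels the top coefficient; the end of the proof recognizes it as the inner product of
   [q] with [p t N]. *)
pose c := q`_N / (p t N)`_N.
have pN0 : (p t N)`_N != 0.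
  by have := orthopoly_neq0 N t1; rewrite -lead_coef_eq0 lead_coefE size_orthopoly.
have sr : (size (q - c *: p t N)%R <= N)%N.
  apply/leq_sizeP => i; rewrite leq_eqVlt => /predU1P[<-|Ni].
    by rewrite coefB coefZ divfK// subrr.
  rewrite coefB coefZ !nth_default ?mulr0 ?subrr//.
    by rewrite size_orthopoly.
  exact: leq_trans sq Ni.
rewrite big_ord_recr/= -[LHS](subrK (c *: p t N)) [X in X + _](IHN _ sr).
congr (_ + _).
  apply: eq_bigr => k _; congr (_ *: _).
  rewrite mulrBl -scaleN1r wintD// wintZ// -scalerAl wintZ// orthonormal//.
  by rewrite gtn_eqF// !mulr0 addr0.
congr (_ *: _).
rewrite -[q in RHS](subrK (c *: p t N)) mulrDl wintD// -scalerAl wintZ//.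
by rewrite orthonormal// eqxx mulr1 mulrC orthopoly_orth// add0r.
Qed.

Definition dstdpoly n t := \poly_(i < n.+1) derive1 (fun s => (y s n)`_i) t.

Lemma is_poly_derive_stdpoly n t :
  is_poly_derive t (fun s => y s n) (dstdpoly n t).
Proof.
move=> i; rewrite coef_poly; case: ltnP => ni.
  by rewrite derive1E; apply: derivableP; exact: derivable_y.
rewrite (_ : (fun s => _) = cst 0); first exact: is_derive_cst.
by apply/funext => s; rewrite nth_default// (leq_trans (size_y s n)).
Qed.

Lemma is_derive_wintM j n m (P Q : R -> {poly R}) (dP dQ : {poly R}) (t : R) :
  -1 < t ->
  (forall s, size (P s) <= n)%N -> (size dP <= n)%N -> is_poly_derive t P dP ->
  (forall s, size (Q s) <= m)%N -> (size dQ <= m)%N -> is_poly_derive t Q dQ ->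
  is_derive t 1 (fun s => wint j s (P s * Q s))
    (wint j.+1 t (P t * Q t) + (wint j t (dP * Q t) + wint j t (P t * dQ))).
Proof.
move=> t1 sP sdP HP sQ sdQ HQ.
have sM (A B : {poly R}) : (size A <= n)%N -> (size B <= m)%N ->
    (size (A * B)%R <= n + m)%N.
  move=> sp sq; apply: leq_trans (size_polyMleq _ _) _.
  exact: leq_trans (leq_pred _) (leq_add sp sq).
rewrite -wintD//; apply: (@is_derive_wint j (n + m) (fun s => P s * Q s)) => //.
- by move=> s; exact: sM.
- by rewrite (leq_trans (size_polyD _ _))// geq_max !sM.
- exact: is_poly_deriveM.
Qed.

Lemma derivable_wnorm n (t : R) : -1 < t -> derivable (d n) t 1.
Proof.
move=> t1; rewrite (_ : d n = Num.sqrt \o (fun s => wint 0 s (y s n * y s n))).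
  have dy := is_poly_derive_stdpoly n t.
  have sy t' := size_y t' n.
  have sdy : (size (dstdpoly n t) <= n.+1)%N by exact: size_poly.
  have dw := is_derive_wintM 0 t1 sy sdy dy sy sdy dy.
  have ds := is_derive1_sqrt (wint_sqr_gt0 t1 (y_neq0 n t1)).
  by have [] := is_derive1_comp ds dw.
by apply/funext => s; rewrite wnormE.
Qed.

Definition dorthopoly n t :=
  derive1 (fun s => (d n s)^-1) t *: y t n + (d n t)^-1 *: dstdpoly n t.

Lemma is_poly_derive_orthopoly n (t : R) : -1 < t ->
  is_poly_derive t (fun s => p s n) (dorthopoly n t).
Proof.
move=> t1; apply: is_poly_deriveZ; last exact: is_poly_derive_stdpoly.
rewrite derive1E; apply: derivableP.
apply: derivableV; first by rewrite gt_eqF// wnorm_gt0.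
exact: derivable_wnorm.
Qed.

Lemma size_dorthopoly n t : (size (dorthopoly n t) <= n.+1)%N.
Proof.
apply: leq_trans (size_polyD _ _) _; rewrite geq_max.
rewrite (leq_trans (size_scale_leq _ _) (size_y t n)).
by rewrite (leq_trans (size_scale_leq _ _))// size_poly.
Qed.

Lemma is_derive_orthopoly n (t x : R) : -1 < t ->
  is_derive t 1 (fun s => (p s n).[x]) (dorthopoly n t).[x].
Proof.
move=> t1; apply: (@is_poly_derive_horner _ _ n.+1).
- by move=> s; exact: size_orthopoly_le.
- exact: size_dorthopoly.
- exact: is_poly_derive_orthopoly.
Qed.

Lemma is_derive_stdpoly n (t x : R) :
  is_derive t 1 (fun s => (y s n).[x]) (dstdpoly n t).[x].
Proof.
apply: (@is_poly_derive_horner _ _ n.+1).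
- by move=> s; exact: size_y.
- exact: size_poly.
- exact: is_poly_derive_stdpoly.
Qed.

(** The expansions of the statement hold pointwise in [x]. Uniqueness of derivatives and the
    vanishing of a polynomial with too many roots turn them into polynomial identities, which can be
    put inside inner products. *)
Lemma param_derive_expansionP (q : R -> nat -> {poly R}) n c (dq : R -> {poly R}) :
  (forall t x : R, -1 < t -> is_derive t 1 (fun s => (q s n).[x]) (dq t).[x]) ->
  param_derive_expansion F q n c <->
  (forall t : R, -1 < t -> dq t = \sum_(k < n.+1) c k t *: q t k).
Proof.
move=> Hq; rewrite /param_derive_expansion paramE; split=> [Hc t t1|Hc t t1 x].
  apply/eqP; rewrite -subr_eq0; apply/eqP/horner0_eq0 => x.
  have := Hc t t1 x; have := Hq t x t1 => -[_ dE] [_]; rewrite dE => {}dE.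
  rewrite hornerD hornerN dE horner_sum.
  by apply/eqP; rewrite subr_eq0; apply/eqP; apply: eq_bigr => k _; rewrite hornerZ.
have := Hq t x t1; rewrite Hc// horner_sum => H; apply: is_derive_eq H _.
by apply: eq_bigr => k _; rewrite hornerZ.
Qed.

Lemma wint_derive_orthonormal n m (t : R) : -1 < t ->
  wint 1 t (p t n * p t m) + (wint 0 t (dorthopoly n t * p t m)
    + wint 0 t (p t n * dorthopoly m t)) = 0.
Proof.
move=> t1.
have [_ <-] := is_derive_wintM 0 t1
  (fun s => size_orthopoly_le s n) (size_dorthopoly n t) (is_poly_derive_orthopoly n t1)
  (fun s => size_orthopoly_le s m) (size_dorthopoly m t) (is_poly_derive_orthopoly m t1).
have : is_derive t 1 (fun s => wint 0 s (p s n * p s m)) 0.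
  apply: (@near_eq_is_derive _ _ _ (cst (n == m)%:R : R -> R)).
  near=> s; rewrite orthonormal//.
  by near: s; exact: near_gtN1.
by case.
Unshelve. all: by end_near. Qed.

(** * Expansion coefficients and the Fisher information *)

Section Expansion.
Variables (n : nat) (At : nat -> R -> R).
Hypothesis AtE : forall t : R, -1 < t ->
  dorthopoly n t = \sum_(k < n.+1) At k t *: p t k.

Lemma expansion_coef k (t : R) : -1 < t -> (k <= n)%N ->
  At k t = wint 0 t (dorthopoly n t * p t k).
Proof.
move=> t1 kn; rewrite AtE//.
by rewrite (wint_orthosum (fun k : 'I_n.+1 => At k t) (Ordinal (kn : k < n.+1)%N) t1).
Qed.

(** In the differentiated relation the derivative of [p t k] has degree at most [k], so it is
    orthogonal to [p t n] and only two terms remain. *)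
Lemma wint1_orthopoly k (t : R) : -1 < t -> (k < n)%N ->
  wint 1 t (p t n * p t k) = - At k t.
Proof.
move=> t1 kn; apply/eqP; rewrite -addr_eq0 expansion_coef ?(ltnW kn)//.
rewrite -(wint_derive_orthonormal n k t1).
by rewrite (orthopoly_orth t1 (leq_trans (size_dorthopoly k t) kn)) addr0.
Qed.

Lemma wint1_orthopoly_sqr (t : R) : -1 < t ->
  wint 1 t (p t n * p t n) = - (2 * At n t).
Proof.
move=> t1; apply/eqP; rewrite -addr_eq0 expansion_coef//.
by rewrite mulr2n mulrDl mul1r -[X in _ == X](wint_derive_orthonormal n n t1)
  [p t n * dorthopoly n t]mulrC.
Qed.

(** The regularity of [At n] is not assumed. It comes from writing [At n] as minus half of a
    weighted integral of the square of [p t n], so that only first derivatives of the polynomial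
    occur. *)
Lemma is_derive_expansion_coef (t : R) : -1 < t ->
  is_derive t 1 (At n) (- (2^-1 * wint 2 t (p t n * p t n)
    + wint 1 t (p t n * dorthopoly n t))).
Proof.
move=> t1; have sp s := size_orthopoly_le s n; have sdp := size_dorthopoly n t.
have dp := is_poly_derive_orthopoly n t1.
have dw := is_derive_wintM 1 t1 sp sdp dp sp sdp dp.
apply: (@near_eq_is_derive _ _ _ (fun s => - (2^-1) * wint 1 s (p s n * p s n))).
  near=> s; rewrite wint1_orthopoly_sqr; last by near: s; exact: near_gtN1.
  by rewrite mulrNN mulKf.
apply: is_derive_eq; rewrite [dorthopoly n t * _]mulrC /GRing.scale/=.
by field.
Unshelve. all: by end_near. Qed.

Lemma wint1_dorthopoly (t : R) : -1 < t ->
  wint 1 t (p t n * dorthopoly n t) = - (\sum_(k < n) At k t ^+ 2) - 2 * At n t ^+ 2.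
Proof.
move=> t1; rewrite {1}AtE// mulr_sumr wint_sum// big_ord_recr/=.
rewrite -scalerAr wintZ// wint1_orthopoly_sqr// -sumrN; congr (_ + _); last by ring.
apply: eq_bigr => k _.
by rewrite -scalerAr wintZ// wint1_orthopoly// expr2 mulrN.
Qed.

Lemma wint0_dorthopoly_sqr (t : R) : -1 < t ->
  wint 0 t (dorthopoly n t * dorthopoly n t) = \sum_(k < n.+1) At k t ^+ 2.
Proof.
move=> t1; rewrite {2}AtE// mulr_sumr wint_sum//.
apply: eq_bigr => k _.
by rewrite -scalerAr wintZ// -expansion_coef// -ltnS.
Qed.

(** The root of exp(t L) is exp((t / 2) L), so the parameter leaves the square root before anything
    is differentiated. *)
Lemma is_derive_root_density (t x : R) : -1 < t -> D x ->
  is_derive t 1 (fun s => root_density F n s x)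
   (Num.sqrt (w0 x) * expR (t / 2 * L x)
      * (2^-1 * L x * (p t n).[x] + (dorthopoly n t).[x])).
Proof.
move=> t1 Dx.
rewrite (_ : (fun s => _) =
    (fun s => Num.sqrt (w0 x) * (expR (s / 2 * L x) * (p s n).[x]))); last first.
  apply/funext => s; rewrite /root_density weightE// sqrtrM ?(ltW (w0_gt0 Dx))//.
  rewrite [s in s * L x](splitr s) mulrDl expRD -expr2 sqrtr_sqr ger0_norm ?expR_ge0//.
  by rewrite mulrA.
have dp := is_derive_orthopoly n x t1.
apply: is_derive_eq; rewrite /GRing.scale/=.
by field.
Qed.

Lemma fisher_informationE (t : R) : -1 < t ->
  fisher_information F n t =
    (2 * (\sum_(k < n) (At k t) ^+ 2) - 2 * derive1 (At n) t)%:E.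
Proof.
move=> t1; rewrite /fisher_information suppE.
(* The squared derivative of the root density, expanded by powers of [L]; the factor 4 in front of
   the integral clears the quarter. *)
pose g x := 4^-1 * weighted 2 t (p t n * p t n) x
  + (weighted 1 t (p t n * dorthopoly n t) x
    + weighted 0 t (dorthopoly n t * dorthopoly n t) x).
have i2 := integrable_weighted 2 (p t n * p t n) t1.
have i1 := integrable_weighted 1 (p t n * dorthopoly n t) t1.
have i0 := integrable_weighted 0 (dorthopoly n t * dorthopoly n t) t1.
have i4 : mu.-integrable D (EFin \o (fun x => 4^-1 * weighted 2 t (p t n * p t n) x)).
  exact: (@integrableZl _ (measurableTypeR R) R lebesgue_measure D mD 4^-1 _ i2).
have i10 : mu.-integrable D (EFin \o (fun x => weighted 1 t (p t n * dorthopoly n t) x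
    + weighted 0 t (dorthopoly n t * dorthopoly n t) x)).
  exact: (@integrableD _ (measurableTypeR R) R lebesgue_measure D mD _ _ i1 i0).
have ig : mu.-integrable D (EFin \o g).
  exact: (@integrableD _ (measurableTypeR R) R lebesgue_measure D mD _ _ i4 i10).
have gE : \int[mu]_(x in D) g x = 4^-1 * wint 2 t (p t n * p t n) +
    (wint 1 t (p t n * dorthopoly n t) + wint 0 t (dorthopoly n t * dorthopoly n t)).
  by rewrite /g RintegralD// RintegralZl// RintegralD.
rewrite (_ : (\int[mu]_(x in D) _)%E = (\int[mu]_(x in D) g x)%:E); last first.
  rewrite /Rintegral fineK; last exact: integrable_fin_num.
  apply: eq_integral => x /set_mem Dx; congr EFin.
  rewrite derive1E; have [_ ->] := is_derive_root_density t1 Dx.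
  rewrite /g /weighted !hornerM !expr0 !expr1 !mul1r !exprMn.
  rewrite sqr_sqrtr ?(ltW (w0_gt0 Dx))//.
  rewrite (_ : expR (t * L x) = expR (t / 2 * L x) * expR (t / 2 * L x)).
    by field.
  by rewrite -expRD -mulrDl -splitr.
(* Write W0, W1, W2 for the three integrals and S for the sum of the squares of [At k t] over k < n.
   The value W2 + 4 W1 + 4 W0 becomes 2 W1 + 4 W0 minus twice the derivative of [At n]; the terms in
   the square of [At n] cancel, leaving 2 S. *)
rewrite gE -EFinM derive1E; have [_ ->] := is_derive_expansion_coef t1.
rewrite wint1_dorthopoly// wint0_dorthopoly_sqr// big_ord_recr/=.
by congr EFin; field.
Qed.

End Expansion.

(** A concrete family then only has to supply integrability, positivity and measurability data,
    degree bounds, nonvanishing, derivability of coefficients and orthogonality. *)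
Theorem exponential_weight_fisher n :
  (forall m t, param F t -> 0 < d m t) /\
  (exists A : nat -> R -> R, param_derive_expansion F (stdpoly F) n A) /\
  (exists At : nat -> R -> R, param_derive_expansion F (orthopoly F) n At) /\
  (forall A At : nat -> R -> R,
     param_derive_expansion F (stdpoly F) n A ->
     param_derive_expansion F (orthopoly F) n At ->
     forall t, param F t ->
       (forall k, (k < n)%N -> At k t = wnorm F k t / wnorm F n t * A k t) /\
       derivable (wnorm F n) t 1 /\
       At n t = A n t - (wnorm F n t)^-1 * derive1 (wnorm F n) t /\
       derivable (At n) t 1 /\
       (forall x, supp_itv F x ->
          derivable (fun s => root_density F n s x) t 1) /\
       fisher_information F n t =
         (2 * (\sum_(k < n) (At k t) ^+ 2) - 2 * derive1 (At n) t)%:E).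
Proof.
have dyE t x : -1 < t -> _ := fun _ => is_derive_stdpoly n t x.
have dpE (t x : R) t1 := @is_derive_orthopoly n t x t1.
split; first by move=> m t; rewrite paramE; exact: wnorm_gt0.
split.
  (* The division by [d k t] converts a coefficient on the orthonormal [p t k] into one on the
     standard polynomial. *)
  exists (fun k t => wint 0 t (dstdpoly n t * p t k) / d k t).
  apply/(param_derive_expansionP _ dyE) => t t1.
  rewrite [LHS](orthopoly_expansion t1 (size_poly _ _)).
  by apply: eq_bigr => k _; rewrite /orthopoly scalerA.
split.
  exists (fun k t => wint 0 t (dorthopoly n t * p t k)).
  apply/(param_derive_expansionP _ dpE) => t t1.
  exact: (orthopoly_expansion t1 (size_dorthopoly n t)).
move=> A At /(param_derive_expansionP _ dyE) HA /(param_derive_expansionP _ dpE) HAt.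
move=> t; rewrite paramE/= => t1.
have dn0 m : d m t != 0 by rewrite gt_eqF// wnorm_gt0.
have Acoef k : (k <= n)%N -> wint 0 t (dstdpoly n t * p t k) = A k t * d k t.
  move=> kn; rewrite HA//.
  under eq_bigr => i _ do rewrite (stdpolyE i t1) scalerA.
  by rewrite (wint_orthosum (fun i : 'I_n.+1 => A i t * d i t)
    (Ordinal (kn : k < n.+1)%N) t1).
(* The derivative of [p t n] has two parts; the one differentiating the norm is a multiple of
   [p t n] and contributes only at [k = n]. *)
have Atcoef k : (k <= n)%N -> At k t =
    derive1 (fun s => (d n s)^-1) t * d n t * (n == k)%:R + A k t * d k t / d n t.
  move=> kn; rewrite (expansion_coef HAt)// /dorthopoly mulrDl wintD//.
  rewrite -!scalerAl !wintZ// Acoef// {1}stdpolyE// -scalerAl wintZ// orthonormal//.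
  by rewrite /GRing.scale/=; ring.
have dw := @derivable_wnorm n t t1.
split=> [k kn|].
  by rewrite Atcoef ?(ltnW kn)// gtn_eqF// mulr0 add0r; ring.
split; first exact: dw.
split.
  rewrite Atcoef// eqxx mulr1 mulfK// addrC; congr (_ + _).
  rewrite !derive1E deriveV// /GRing.scale/=.
  by field.
split; first by have [] := is_derive_expansion_coef HAt t1.
split; last exact: fisher_informationE.
by move=> x; rewrite suppE => Dx; have [] := @is_derive_root_density n t x t1 Dx.
Qed.

End ExponentialWeight.

(** * Algebra of the Laguerre and Jacobi polynomials *)

(** A translation preserves degree and leading coefficient, so the difference loses a degree. *)
Lemma size_sub_shift (R : idomainType) (n : nat) (p : {poly R}) :
  (size p <= n.+1)%N -> (size (p - (p \Po ('X + 1)))%R <= n)%N.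
Proof.
move=> sp; have sX : size ('X + 1 : {poly R}) = 2 by rewrite -polyC1 size_XaddC.
have lX : lead_coef ('X + 1 : {poly R}) = 1 by rewrite -polyC1 lead_coefXaddC.
have sc := size_comp_poly2 p sX.
apply/leq_sizeP => j; rewrite leq_eqVlt => /predU1P[<-|nj]; last first.
  by rewrite coefB !nth_default ?subrr ?sc// (leq_trans sp nj).
move: sp; rewrite coefB leq_eqVlt => /predU1P[sp|]; last first.
  by rewrite ltnS => sp; rewrite !nth_default ?subrr ?sc.
have := @lead_coef_comp _ p ('X + 1); rewrite sX => /(_ isT).
by rewrite lX expr1n mulr1 !lead_coefE sc sp/= => ->; rewrite subrr.
Qed.

(* The sum is, up to sign, the [n]-th finite difference of [p] at [0]. *)
Lemma alternating_binomial_sum (R : idomainType) (n : nat) (p : {poly R}) :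
  (size p <= n)%N ->
  \sum_(s < n.+1) (-1) ^+ s * 'C(n, s)%:R * p.[s%:R] = 0.
Proof.
elim: n p => [|n IHn] p sp.
  move: sp; rewrite leqn0 size_poly_eq0 => /eqP ->.
  by rewrite big1// => s _; rewrite horner0 mulr0.
have := IHn _ (size_sub_shift sp).
under eq_bigr => s _.
  rewrite hornerD hornerN horner_comp !hornerE mulrBr natr1.
  over.
rewrite sumrB big_ord_recl/= bin0 !mul1r => IH; rewrite -[RHS]IH.
rewrite big_ord_recl/= bin0 expr0 !mul1r.
(* Appending the null term with ['C(n, n.+1) = 0] gives both sums the same range, and Pascal's rule
   then applies termwise. *)
rewrite -addrA; congr (_ + _); rewrite [X in _ = X - _](_ : _ =
  \sum_(i < n.+1) (-1) ^+ i.+1 * 'C(n, i.+1)%:R * p.[i.+1%:R]); last first.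
  by rewrite [RHS]big_ord_recr/= bin_small// mulr0 mul0r addr0.
rewrite -sumrB; apply: eq_bigr => i _.
by rewrite /bump/= add1n binS natrD -natr1 exprS; ring.
Qed.

Lemma derivable_gbinom (R : realType) (n m : nat) (t : R) :
  derivable (fun s : R => gbinom (n%:R + s) m) t 1.
Proof.
rewrite /gbinom; apply: derivableM; last exact: derivable_cst.
elim: m => [|m IHm].
  by under eq_fun do rewrite big_ord0; exact: derivable_cst.
under eq_fun do rewrite big_ord_recr/=.
apply: derivableM => //.
Qed.

Lemma gbinom_gt0 (R : realType) (a : R) (n : nat) : -1 < a ->
  0 < gbinom (n%:R + a) n.
Proof.
move=> a1; rewrite divr_gt0 ?ltr0n ?fact_gt0// prodr_gt0// => i _.
have : (i.+1%:R <= n%:R :> R) by rewrite ler_nat.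
by rewrite -natr1; lra.
Qed.

Lemma gbinom0 (R : realType) (a : R) : gbinom a 0 = 1.
Proof. by rewrite /gbinom big_ord0 fact0 divr1. Qed.

Section Laguerre.
Context {R : realType}.
Implicit Types (a : R) (n : nat).

Lemma coef_laguerre a n i : (laguerre a n)`_i =
  if (i < n.+1)%N then (-1) ^+ i * gbinom (n%:R + a) (n - i) / (i`!)%:R else 0.
Proof.
rewrite -[RHS](coef_poly n.+1 (fun i =>
  (-1) ^+ i * gbinom (n%:R + a) (n - i) / (i`!)%:R)).
by rewrite poly_def.
Qed.

Lemma size_laguerre a n : (size (laguerre a n) <= n.+1)%N.
Proof. by apply/leq_sizeP => j nj; rewrite coef_laguerre ltnNge nj. Qed.

Lemma laguerre_neq0 a n : laguerre a n != 0.
Proof.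
apply/negP => /eqP/(congr1 (fun p : {poly R} => p`_n))/eqP.
rewrite coef_laguerre ltnSn subnn gbinom0 coef0 mulr1 mulf_eq0 signr_eq0/=.
by rewrite invr_eq0 pnatr_eq0 -leqn0 leqNgt fact_gt0.
Qed.

Lemma derivable_coef_laguerre n i (t : R) :
  derivable (fun s : R => (laguerre s n)`_i) t 1.
Proof.
under eq_fun do rewrite coef_laguerre.
case: ifP => _; last exact: derivable_cst.
apply: derivableM; last exact: derivable_cst.
apply: derivableM; first exact: derivable_cst.
exact: derivable_gbinom.
Qed.

End Laguerre.

Section Jacobi.
Context {R : realType}.
Implicit Types (a b : R) (n : nat).

Lemma size_jacobi a b n : (size (jacobi a b n) <= n.+1)%N.
Proof.
apply: (big_ind (fun p : {poly R} => (size p <= n.+1)%N)).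
- by rewrite size_poly0.
- move=> p q sp sq; apply: leq_trans (size_polyD _ _) _.
  by rewrite geq_max sp.
move=> s _; apply: leq_trans (size_scale_leq _ _) _.
apply: leq_trans (size_polyMleq _ _) _.
rewrite -[1]polyC1 size_exp_XsubC -[1%:P]opprK -polyCN size_exp_XsubC addSn addnS/=.
by rewrite subnKC// -ltnS.
Qed.

(** Evaluation at 1 kills every term with s > 0 and leaves a positive binomial, which is simpler
    than controlling the leading coefficient, a sum over all [s]. *)
Lemma jacobi_neq0 a b n : -1 < a -> jacobi a b n != 0.
Proof.
move=> a1; apply/negP => /eqP/(congr1 (fun p => p.[1]))/eqP.
rewrite horner0 /jacobi horner_sum big_ord_recl/= big1 ?addr0 => [|s _].
  rewrite subn0 gbinom0 !hornerE/= !mulr1 (_ : 1 + 1 = 2)// divfK ?expf_neq0//.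
  by rewrite gt_eqF// gbinom_gt0.
by rewrite !hornerE/= subrr exprS !mul0r mulr0 mul0r.
Qed.

(** Two curves [u] and [v] cover both Jacobi families at once: one is the identity, the other
    constant. *)
Lemma derivable_coef_jacobi (u v : R -> R) n i (t : R) :
  (forall m, derivable (fun s : R => gbinom (n%:R + u s) m) t 1) ->
  (forall m, derivable (fun s : R => gbinom (n%:R + v s) m) t 1) ->
  derivable (fun s : R => (jacobi (u s) (v s) n)`_i) t 1.
Proof.
move=> du dv.
rewrite (_ : (fun s => _) = \sum_(k < n.+1) (fun s =>
    gbinom (n%:R + u s) (n - k) * gbinom (n%:R + v s) k / 2 ^+ n *
      (('X - 1) ^+ k * ('X + 1) ^+ (n - k) : {poly R})`_i)); last first.
  by apply/funext => s; rewrite fct_sumE coef_sum; apply: eq_bigr => k _; rewrite coefZ.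
apply: derivable_sum => s.
apply: derivableM; last exact: derivable_cst.
apply: derivableM; last exact: derivable_cst.
by apply: derivableM; [exact: du|exact: dv].
Qed.

End Jacobi.

(** * Laguerre weight *)

Section LinearCombination.
Context {R : realType}.
Notation mu := (@lebesgue_measure R).
Variables (D : set R) (I : Type) (c : I -> R) (f : I -> R -> R).
Hypothesis mD : @measurable _ (measurableTypeR R) D.
Hypothesis fi : forall i, mu.-integrable D (EFin \o f i).

Lemma integrable_lincomb (r : seq I) :
  mu.-integrable D (EFin \o (fun x => \sum_(i <- r) c i * f i x)).
Proof.
elim: r => [|i r IHr].
  rewrite (_ : _ \o _ = cst 0%E); first exact: integrable0.
  by apply/funext => x /=; rewrite big_nil.
rewrite (_ : _ \o _ = (fun x => (c i)%:E * (f i x)%:E)%E \+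
    (EFin \o (fun x => \sum_(i <- r) c i * f i x))); last first.
  by apply/funext => x /=; rewrite big_cons EFinD EFinM.
exact: (@integrableD _ (measurableTypeR R) R lebesgue_measure D mD _ _
  (integrableZl mD _ (fi i)) IHr).
Qed.

Lemma Rintegral_lincomb (r : seq I) :
  \int[mu]_(x in D) (\sum_(i <- r) c i * f i x) =
  \sum_(i <- r) c i * \int[mu]_(x in D) f i x.
Proof.
elim: r => [|i r IHr].
  under eq_Rintegral do rewrite big_nil.
  by rewrite Rintegral_cst// mul0r big_nil.
under eq_Rintegral do rewrite big_cons.
rewrite big_cons RintegralD ?RintegralZl ?IHr//.
- exact: (integrableZl mD _ (fi i)).
- exact: integrable_lincomb.
Qed.

End LinearCombination.

(** * Compact exhaustions of the two intervals *)

Section Exhaustions.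
Context {R : realType}.

(* With [n.+1] in place of [n.+2], the first truncated interval ([shrink 0, 1] or
   [-1 + shrink 0, 1 - shrink 0]) would be reduced to a point. *)
Definition shrink (n : nat) : R := n.+2%:R^-1.

Lemma shrink_gt0 n : 0 < shrink n.
Proof. by rewrite invr_gt0 ltr0n. Qed.

Lemma shrink_lt1 n : shrink n < 1.
Proof. by rewrite invf_lt1 ?ltr0n// ltr1n. Qed.

Lemma nonincreasing_shrink : nonincreasing_seq shrink.
Proof. by move=> m n mn; rewrite lef_pV2 ?posrE ?ltr0n// ler_nat !ltnS. Qed.

Lemma shrink_lt (x : R) : 0 < x -> exists N, shrink N < x.
Proof.
move=> x0; exists (Num.truncn x^-1).
rewrite invf_plt ?posrE ?ltr0n//.
apply: (lt_le_trans (truncnS_gt _)); by rewrite ler_nat.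
Qed.

Lemma cvg_powR_shrink (a : R) : 0 < a -> shrink n `^ a @[n --> \oo] --> 0.
Proof.
move=> a0; apply/cvgrPdist_lt => e e0.
(* The target [e] is the [a]-th power of [e] to the 1/a, so it is enough that [shrink N] falls below
   the latter. *)
have [N ltN] := shrink_lt (powR_gt0 a^-1 e0).
near=> n; rewrite sub0r normrN ger0_norm ?powR_ge0//.
rewrite -[ltRHS](powRr1 (ltW e0)) -(mulVf (lt0r_neq0 a0)) powRrM.
apply: gt0_ltr_powR; rewrite ?nnegrE ?powR_ge0//; first exact/ltW/shrink_gt0.
apply: le_lt_trans ltN; apply: nonincreasing_shrink.
by near: n; exact: nbhs_infty_ge.
Unshelve. all: by end_near. Qed.

Lemma cvg_shrink : shrink n @[n --> \oo] --> 0.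
Proof.
have := cvg_powR_shrink (@ltr01 R); apply: cvg_trans; apply: near_eq_cvg.
by near=> n; rewrite powRr1// ltW// shrink_gt0.
Unshelve. all: by end_near. Qed.

Lemma bigcup_itv0y :
  `]0%R, +oo[%classic = \bigcup_n [set` `[shrink n, n.+2%:R]] :> set R.
Proof.
apply/seteqP; split => x /=; rewrite in_itv/= ?andbT.
  move=> x0; have [N HN] := shrink_lt x0.
  have xV0 : 0 < x^-1 by rewrite invr_gt0.
  have [M HM] := shrink_lt xV0.
  exists (maxn N M) => //=; rewrite in_itv/=; apply/andP; split.
    by apply: le_trans (ltW HN); apply: nonincreasing_shrink; exact: leq_maxl.
  move: HM; rewrite /shrink ltf_pV2 ?posrE ?ltr0n// => /ltW/le_trans; apply.
  by rewrite ler_nat !ltnS leq_maxr.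
by move=> [n _] /=; rewrite in_itv/= => /andP[+ _]; apply: lt_le_trans (shrink_gt0 n).
Qed.

Lemma bigcup_itvN11 :
  `](-1)%R, 1%R[%classic =
    \bigcup_n [set` `[-1 + shrink n, 1 - shrink n]] :> set R.
Proof.
apply/seteqP; split => x /=; rewrite in_itv/=.
  move=> /andP[x1 x2].
  have x10 : 0 < x + 1 by rewrite -ltrBlDr sub0r.
  have x20 : 0 < 1 - x by rewrite subr_gt0.
  have [N HN] := shrink_lt x10.
  have [M HM] := shrink_lt x20.
  exists (maxn N M) => //=; rewrite in_itv/=.
  have := nonincreasing_shrink (leq_maxl N M).
  have := nonincreasing_shrink (leq_maxr N M).
  by move=> h1 h2; apply/andP; split; lra.
move=> [n _] /=; rewrite in_itv/= => /andP[h1 h2].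
by have := shrink_gt0 n => h3; apply/andP; split; lra.
Qed.

Lemma derivable_continuous (f : R -> R) x :
  derivable f x 1 -> {for x, continuous f}.
Proof. by move=> df; apply/differentiable_continuous/derivable1_diffP. Qed.

End Exhaustions.

(** For an integer k > a, (1 + x)^k / k! is a term of the series of exp(1 + x); hence the constant
    k! e. *)
Lemma powR_le_expR (R : realType) (a : R) :
  exists2 C : R, 0 < C & forall x, 0 <= x -> (1 + x) `^ a <= C * expR x.
Proof.
pose k := (Num.truncn a).+1.
exists (k`!%:R * expR 1); first by rewrite mulr_gt0 ?ltr0n ?fact_gt0 ?expR_gt0.
move=> x x0; have x1 : 1 <= 1 + x by rewrite lerDl.
apply: (@le_trans _ _ ((1 + x) `^ k%:R)).
  by rewrite ler_powR// ltW// truncnS_gt.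
rewrite powR_mulrn ?(le_trans ler01)// -mulrA -expRD -ler_pdivrMl ?ltr0n ?fact_gt0//.
have := expR_ge1Dxn (Num.truncn a) (le_trans ler01 x1); apply: le_trans.
by rewrite mulrC lerDr ler01.
Qed.

Section LaguerreWeight.
Context {R : realType}.
Notation mu := (@lebesgue_measure R).
Notation pos := (`]0%R, +oo[%classic : set R).

Definition laguerre_weight (s x : R) : R := expR (- x) * x `^ s.

Lemma is_derive_laguerre_weight (s x : R) : 0 < x ->
  is_derive x 1 (laguerre_weight s)
    (s * laguerre_weight (s - 1) x - laguerre_weight s x).
Proof.
move=> x0; have dp := is_derive1_powR s x0.
have de : is_derive x 1 (fun y => expR (- y)) (- expR (- x)).
  by apply: is_derive_eq; rewrite mulrN1.
apply: is_derive_eq; rewrite /laguerre_weight /GRing.scale/=; ring.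
Qed.

(* [unitize x = x / (1 + x)] maps the half-line onto ]0, 1[, which gives the
   integrable majorant [unitize x `^ s * (1 + x) ^- 2] an explicit primitive. *)
Let unitize (x : R) := 1 - (1 + x)^-1.

Let unitizeE x : 0 < x -> unitize x = x / (1 + x).
Proof.
move=> x0; have x10 : 1 + x != 0 by rewrite gt_eqF// addr_gt0.
by rewrite /unitize; field.
Qed.

Let is_derive_powR_unitize (s x : R) : 0 < x ->
  is_derive x 1 (fun y => unitize y `^ s)
    (s * unitize x `^ (s - 1) * (1 + x) ^- 2).
Proof.
move=> x0; have x10 : 0 < 1 + x by rewrite addr_gt0.
have du : is_derive x 1 unitize ((1 + x) ^- 2).
  have dv : is_derive x 1 (fun y : R => 1 + y) 1.
    by apply: is_derive_eq; rewrite add0r mulr1.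
  have x1n : 1 + x != 0 by rewrite gt_eqF.
  have dV := is_deriveV x1n dv.
  apply: is_derive_eq; rewrite /GRing.scale/=; ring.
have u0 : 0 < unitize x by rewrite unitizeE// divr_gt0.
exact: (is_derive1_comp (is_derive1_powR s u0) du).
Qed.

Lemma integrable_laguerre_weight (s : R) : -1 < s ->
  mu.-integrable pos (EFin \o laguerre_weight s).
Proof.
move=> s1; pose g x := unitize x `^ s * (1 + x) ^- 2.
have s10 : s + 1 != 0 by rewrite gt_eqF// -ltrBlDr sub0r.
have pos0 x : pos x -> 0 < x by rewrite /= in_itv/= andbT.
have ig : mu.-integrable pos (EFin \o g).
  apply: (@integrable_exhaustion _ _ shrink (fun n => n.+2%:R) g
    (fun x => unitize x `^ (s + 1) / (s + 1)) _ _ _ bigcup_itv0y _ _ (s + 1)^-1).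
  - by move=> n; rewrite (lt_le_trans (shrink_lt1 n))// ler1n.
  - exact: nonincreasing_shrink.
  - by move=> m n mn; rewrite ler_nat !ltnS.
  - move=> x /pos0 x0; have dp := is_derive_powR_unitize (s + 1) x0.
    apply: is_derive_eq; rewrite addrK /g /GRing.scale/=.
    by field; rewrite s10 gt_eqF// addr_gt0.
  - move=> x /pos0 x0; apply: derivable_continuous.
    have dp := is_derive_powR_unitize s x0.
    apply: derivableM; first by case: dp.
    by apply: derivableV => //; rewrite expf_neq0// gt_eqF// addr_gt0.
  - move=> x /pos0 x0.
    by rewrite mulr_ge0 ?powR_ge0// invr_ge0 exprn_ge0// addr_ge0 ?ltW.
  move=> n; rewrite lerBlDr.
  have r0 : 0 < n.+2%:R :> R by rewrite ltr0n.
  have s0 : 0 < s + 1 by rewrite -ltrBlDr sub0r.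
  apply: (@le_trans _ _ (s + 1)^-1); last first.
    by rewrite lerDl divr_ge0 ?powR_ge0// ltW.
  rewrite ler_piMl ?invr_ge0 ?(ltW s0)// unitizeE//.
  apply: (@le_trans _ _ (1 `^ (s + 1))); last by rewrite powR1.
  apply: ge0_ler_powR; rewrite ?nnegrE ?ler01 ?(ltW s0)//.
  by rewrite ler_pdivrMr ?addr_gt0// mul1r lerDr.
(* The exponent [s + 2] is the one for which x^s / (1 + x)^(s + 2) equals [g]. *)
have [C C0 HC] := powR_le_expR (s + 2).
apply: (@le_integrable _ (measurableTypeR R) R lebesgue_measure pos _ _
  (fun x => (C%:E * (g x)%:E)%E)) => //.
- apply/measurable_EFinP; apply: measurable_funM.
    by apply: (measurableT_comp (@measurable_expR R)); exact: measurable_funN.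
  by apply: measurable_funTS; exact: measurable_powR.
- move=> x /pos0 x0 /=; rewrite lee_fin.
  rewrite ger0_norm ?mulr_ge0 ?expR_ge0 ?powR_ge0//.
  have x10 : 0 < 1 + x by rewrite addr_gt0.
  have -> : g x = x `^ s / (1 + x) `^ (s + 2).
    rewrite /g unitizeE// powRM ?invr_ge0 ?ltW// -[(1 + x)^-1]powR_inv1 ?ltW//.
    rewrite -powRrM mulN1r powRN -mulrA -invfM powRD; last by rewrite (gt_eqF x10) implybT.
    by rewrite powR_mulrn// ltW.
  rewrite ger0_norm; last by rewrite mulr_ge0 ?divr_ge0 ?powR_ge0 ?ltW.
  rewrite /laguerre_weight expRN mulrC mulrCA ler_wpM2l ?powR_ge0//.
  rewrite ler_pdivlMr ?powR_gt0// mulrC ler_pdivrMr ?expR_gt0//.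
  by apply: HC; exact: ltW.
- by apply: integrableZl.
Qed.

(** The functional equation of Gamma: the difference of the two integrands is the derivative of
    [laguerre_weight (s + 1)], which tends to 0 at both ends. *)
Lemma Rintegral_laguerre_weightS (s : R) : -1 < s ->
  \int[mu]_(x in pos) laguerre_weight (s + 1) x =
  (s + 1) * \int[mu]_(x in pos) laguerre_weight s x.
Proof.
move=> s1; have s0 : 0 < s + 1 by rewrite -ltrBlDr sub0r.
have s2 : -1 < s + 1 by rewrite (lt_trans _ s0)// ltrN10.
have pos0 x : pos x -> 0 < x by rewrite /= in_itv/= andbT.
have i0 := integrable_laguerre_weight s1.
have i1 := integrable_laguerre_weight s2.
have is0 : mu.-integrable pos (EFin \o (fun x => (s + 1) * laguerre_weight s x)).
  exact: (@integrableZl _ (measurableTypeR R) R lebesgue_measure pos _ _ _ i0).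
apply/esym/eqP; rewrite -subr_eq0 -RintegralZl// -RintegralB//; apply/eqP.
apply: (@Rintegral_exhaustion _ _ shrink (fun n => n.+2%:R)
  _ (laguerre_weight (s + 1)) _ _ _ bigcup_itv0y).
- by move=> n; rewrite (lt_le_trans (shrink_lt1 n))// ler1n.
- exact: nonincreasing_shrink.
- by move=> m n mn; rewrite ler_nat !ltnS.
- move=> x /pos0 x0; have dp := is_derive_laguerre_weight (s + 1) x0.
  by apply: is_derive_eq; rewrite addrK.
- move=> x /pos0 x0; apply: derivable_continuous.
  have d1 := is_derive_laguerre_weight (s + 1) x0.
  have d0 := is_derive_laguerre_weight s x0.
  by apply: derivableB; [apply: derivableM => //; case: d0|case: d1].
- exact: (@integrableB _ (measurableTypeR R) R lebesgue_measure pos _ _ _ is0 i1).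
rewrite -[X in _ --> X](subr0 0); apply: cvgB.
(* One power more than the weight carries, so that the spare factor yields the bound
   [C * shrink n]. *)
- have [C C0 HC] := powR_le_expR (s + 1 + 1).
  apply: (@squeeze_cvgr _ _ _ _ (cst 0) (fun n => C * shrink n)).
  + near=> n; rewrite mulr_ge0 ?expR_ge0 ?powR_ge0//=.
    have r0 : 0 < n.+2%:R :> R by rewrite ltr0n.
    rewrite /laguerre_weight expRN mulrC ler_pdivrMr ?expR_gt0// mulrAC.
    rewrite ler_pdivlMr//; apply: le_trans (HC _ (ltW r0)).
    rewrite -[X in _ * X <= _](powRr1 (ltW r0)) -powRD; last by rewrite (gt_eqF r0) implybT.
    apply: ge0_ler_powR; rewrite ?nnegrE ?(ltW r0)//.
    * by rewrite addr_ge0// ltW.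
    * by rewrite lerDr.
  + exact: cvg_cst.
  + by rewrite -[X in _ --> X](mulr0 C); apply: cvgM; [exact: cvg_cst|exact: cvg_shrink].
- apply: (@squeeze_cvgr _ _ _ _ (cst 0) (fun n => shrink n `^ (s + 1))).
  + near=> n; rewrite mulr_ge0 ?expR_ge0 ?powR_ge0//=.
    rewrite ler_piMl ?powR_ge0// -expR0 ler_expR oppr_le0 ltW//.
    exact: shrink_gt0.
  + exact: cvg_cst.
  + exact: cvg_powR_shrink.
Unshelve. all: by end_near. Qed.

End LaguerreWeight.

(** * Moments and orthogonality for Laguerre *)

Lemma prod_shift_poly (R : idomainType) (c : nat -> R) (j : nat) :
  exists2 P : {poly R}, size P = j.+1 & forall x, P.[x] = \prod_(k < j) (x + c k).
Proof.
exists (\prod_(k < j) ('X - (- c k)%:P)) => [|x].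
  by rewrite size_prod_XsubC -sum1_size sum_nat_const card_ord muln1.
by rewrite horner_prod; apply: eq_bigr => k _; rewrite !hornerE opprK.
Qed.

Lemma bin_invfact (R : numFieldType) (n s : nat) : (s <= n)%N ->
  ((n - s)`!%:R)^-1 * (s`!%:R)^-1 = 'C(n, s)%:R / n`!%:R :> R.
Proof.
move=> sn; rewrite -(bin_fact sn) !natrM.
have f0 m : m`!%:R != 0 :> R by rewrite pnatr_eq0 -lt0n fact_gt0.
have b0 : 'C(n, s)%:R != 0 :> R by rewrite pnatr_eq0 -lt0n bin_gt0.
by field; rewrite !f0 b0.
Qed.

Section LaguerreOrthogonality.
Context {R : realType}.
Notation mu := (@lebesgue_measure R).
Notation pos := (`]0%R, +oo[%classic : set R).
Variable a : R.
Hypothesis a1 : -1 < a.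

Let M (s : nat) := \int[mu]_(x in pos) laguerre_weight (a + s%:R) x.

Let as1 s : -1 < a + s%:R.
Proof. by rewrite (lt_le_trans a1)// lerDl. Qed.

Let MS s : M s.+1 = (a + s%:R + 1) * M s.
Proof. by rewrite /M -Rintegral_laguerre_weightS// -addrA natr1. Qed.

(** The falling product is the numerator of the binomial in the [i]-th Laguerre coefficient when m =
    n - i; it lifts [M i] to [M n], which no longer depends on [i]. *)
Let M_fall m i : (\prod_(k < m) ((m + i)%:R + a - k%:R)) * M i = M (m + i).
Proof.
elim: m => [|m IHm]; first by rewrite big_ord0 mul1r.
rewrite addSn MS -IHm big_ord_recl/= subr0 -mulrA; congr (_ * (_ * _)).
  by rewrite -natr1; ring.
apply: eq_bigr => k _; rewrite /bump/= -natr1 natrD; ring.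
Qed.

(** The product is a polynomial of degree [j] in [i], the form that a finite difference of higher
    order annihilates. *)
Let M_rise i j : M (i + j) = \prod_(k < j) (i%:R + (a + 1 + k%:R)) * M i.
Proof.
elim: j => [|j IHj]; first by rewrite big_ord0 addn0 mul1r.
by rewrite addnS MS IHj big_ord_recr/= natrD; ring.
Qed.

(* Up to a factor independent of [i], the [i]-th summand is [(-1)^i 'C(n, i)] times
   a polynomial of degree [j] in [i]. *)
Let laguerre_moment n j : (j < n)%N ->
  \sum_(i < n.+1) (laguerre a n)`_i * M (i + j) = 0.
Proof.
move=> jn; have [P sP PE] := prod_shift_poly (fun k => a + 1 + k%:R) j.
have := @alternating_binomial_sum R n P; rewrite sP => /(_ jn) H0.
transitivity (M n / n`!%:R *
    \sum_(s < n.+1) (-1) ^+ s * 'C(n, s)%:R * P.[s%:R]); last by rewrite H0 mulr0.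
rewrite mulr_sumr; apply: eq_bigr => i _.
have iN : (i <= n)%N by rewrite -ltnS.
have := M_fall (n - i) i; rewrite subnK// => <-.
rewrite coef_laguerre ltn_ord M_rise PE /gbinom.
transitivity ((-1) ^+ i * ((\prod_(k < n - i) (n%:R + a - k%:R)) * M i) *
  (\prod_(k < j) (i%:R + (a + 1 + k%:R))) * (((n - i)`!%:R)^-1 * (i`!%:R)^-1)).
  by ring.
by rewrite bin_invfact//; ring.
Qed.

Lemma integrable_laguerre_poly (q : {poly R}) :
  mu.-integrable pos (EFin \o (fun x => laguerre_weight a x * q.[x])).
Proof.
have := @integrable_lincomb _ pos 'I_(size q) (fun i => q`_i)
  (fun i => laguerre_weight (a + i%:R)) _ _ (index_enum _).
move=> /(_ _ _)/eq_integrable; apply => //; last first.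
  by move=> i; apply: integrable_laguerre_weight; exact: as1.
move=> x; rewrite inE/= in_itv/= andbT => x0; congr EFin.
rewrite horner_coef mulr_sumr; apply: eq_bigr => i _.
rewrite /laguerre_weight powRD; last by rewrite (gt_eqF x0) implybT.
by rewrite powR_mulrn ?ltW//; ring.
Qed.

Lemma laguerre_orth n (q : {poly R}) : (size q <= n)%N ->
  \int[mu]_(x in pos) (laguerre_weight a x * (laguerre a n * q).[x]) = 0.
Proof.
move=> sq.
pose f (j : 'I_n) x := \sum_(i < n.+1) (laguerre a n)`_i *
  laguerre_weight (a + (i + j)%:R) x.
have fi (j : 'I_n) (i : 'I_n.+1) :
    mu.-integrable pos (EFin \o laguerre_weight (a + (i + j)%:R)).
  by apply: integrable_laguerre_weight; exact: as1.
transitivity (\int[mu]_(x in pos) \sum_(j < n) q`_j * f j x).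
  apply: eq_Rintegral => x; rewrite inE/= in_itv/= andbT => x0.
  rewrite hornerM (horner_coef_wide _ (size_laguerre a n)) (horner_coef_wide _ sq).
  rewrite mulr_sumr mulr_sumr; apply: eq_bigr => j _.
  rewrite mulrA mulr_sumr mulr_suml /f mulr_sumr; apply: eq_bigr => i _.
  rewrite /laguerre_weight powRD; last by rewrite (gt_eqF x0) implybT.
  by rewrite powR_mulrn ?ltW// exprD; ring.
rewrite Rintegral_lincomb//; last by move=> j; exact: integrable_lincomb.
rewrite big1// => j _.
by rewrite Rintegral_lincomb// laguerre_moment ?mulr0.
Qed.

End LaguerreOrthogonality.

(** * Jacobi weight *)

Section JacobiWeight.
Context {R : realType}.
Notation mu := (@lebesgue_measure R).
Notation itv := (`](-1)%R, 1%R[%classic : set R).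

Definition jacobi_weight (a b x : R) : R := (1 - x) `^ a * (1 + x) `^ b.

Lemma itvN11_gt0 x : itv x -> 0 < 1 - x /\ 0 < 1 + x.
Proof.
by rewrite /= in_itv/= => /andP[x1 x2]; rewrite subr_gt0 -ltrBlDl sub0r.
Qed.

Lemma is_derive_powR_1B (a x : R) : 0 < 1 - x ->
  is_derive x 1 (fun y => (1 - y) `^ a) (- (a * (1 - x) `^ (a - 1))).
Proof.
move=> x1; have dv : is_derive x 1 (fun y : R => 1 - y) (- 1).
  by apply: is_derive_eq; ring.
have d := @is_derive1_comp R (fun z => z `^ a) (fun y => 1 - y) x _ _
  (is_derive1_powR a x1) dv.
by apply: is_derive_eq; rewrite mulrN1.
Qed.

Lemma is_derive_powR_1D (b x : R) : 0 < 1 + x ->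
  is_derive x 1 (fun y => (1 + y) `^ b) (b * (1 + x) `^ (b - 1)).
Proof.
move=> x1; have dv : is_derive x 1 (fun y : R => 1 + y) 1.
  by apply: is_derive_eq; ring.
have d := @is_derive1_comp R (fun z => z `^ b) (fun y => 1 + y) x _ _
  (is_derive1_powR b x1) dv.
by apply: is_derive_eq; rewrite mulr1.
Qed.

Lemma is_derive_jacobi_weight (a b x : R) : 0 < 1 - x -> 0 < 1 + x ->
  is_derive x 1 (jacobi_weight a b)
    (b * jacobi_weight a (b - 1) x - a * jacobi_weight (a - 1) b x).
Proof.
move=> x1 x2; have d1 := is_derive_powR_1B a x1; have d2 := is_derive_powR_1D b x2.
apply: is_derive_eq; rewrite /jacobi_weight /GRing.scale/=; ring.
Qed.

Let l n : R := -1 + shrink n.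
Let r n : R := 1 - shrink n.

Let l_lt_r n : l n < r n.
Proof. by have := @shrink_lt1 R n; rewrite /l /r => h; lra. Qed.

Let l_ni : nonincreasing_seq l.
Proof. by move=> m n mn; rewrite lerD2l; exact: nonincreasing_shrink. Qed.

Let r_nd : nondecreasing_seq r.
Proof. by move=> m n mn; rewrite lerD2l lerN2; exact: nonincreasing_shrink. Qed.

Let lr_itv n : itv (l n) /\ itv (r n).
Proof.
have s0 := @shrink_gt0 R n; have s1 := @shrink_lt1 R n.
by rewrite /l /r; split; rewrite /= in_itv/=; apply/andP; split; lra.
Qed.

Let powR2_ge (c x : R) : -1 < c -> 0 < x -> x <= 2 -> x `^ (c + 1) <= 2 `^ (c + 1).
Proof.
move=> c1 x0 x2; have c0 : 0 <= c + 1 by rewrite ltW// -ltrBlDr sub0r.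
by apply: ge0_ler_powR; rewrite ?nnegrE ?(ltW x0).
Qed.

Let integrable_powR_1B (a : R) : -1 < a ->
  mu.-integrable itv (EFin \o (fun x => (1 - x) `^ a)).
Proof.
move=> a1; have a0 : a + 1 != 0 by rewrite gt_eqF// -ltrBlDr sub0r.
have c0 : 0 < a + 1 by rewrite -ltrBlDr sub0r.
apply: (@integrable_exhaustion _ _ l r _
    (fun x => - ((1 - x) `^ (a + 1) / (a + 1))) l_lt_r l_ni r_nd bigcup_itvN11 _ _
    (2 `^ (a + 1) / (a + 1))).
- move=> x /itvN11_gt0[x1 _]; have dp := is_derive_powR_1B (a + 1) x1.
  by apply: is_derive_eq; rewrite addrK /GRing.scale/=; field.
- move=> x /itvN11_gt0[x1 _]; apply: derivable_continuous.
  by have [] := is_derive_powR_1B a x1.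
- by move=> x _; exact: powR_ge0.
move=> n; rewrite opprK addrC.
apply: (@le_trans _ _ ((1 - l n) `^ (a + 1) / (a + 1))).
  by rewrite gerDl oppr_le0 divr_ge0 ?powR_ge0// ltW.
have [/itvN11_gt0[l1 l2] _] := lr_itv n.
by rewrite ler_pM2r ?invr_gt0// powR2_ge//; lra.
Qed.

Let integrable_powR_1D (b : R) : -1 < b ->
  mu.-integrable itv (EFin \o (fun x => (1 + x) `^ b)).
Proof.
move=> b1; have b0 : b + 1 != 0 by rewrite gt_eqF// -ltrBlDr sub0r.
have c0 : 0 < b + 1 by rewrite -ltrBlDr sub0r.
apply: (@integrable_exhaustion _ _ l r _
    (fun x => (1 + x) `^ (b + 1) / (b + 1)) l_lt_r l_ni r_nd bigcup_itvN11 _ _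
    (2 `^ (b + 1) / (b + 1))).
- move=> x /itvN11_gt0[_ x1]; have dp := is_derive_powR_1D (b + 1) x1.
  by apply: is_derive_eq; rewrite addrK /GRing.scale/=; field.
- move=> x /itvN11_gt0[_ x1]; apply: derivable_continuous.
  by have [] := is_derive_powR_1D b x1.
- by move=> x _; exact: powR_ge0.
move=> n; apply: (@le_trans _ _ ((1 + r n) `^ (b + 1) / (b + 1))).
  by rewrite gerDl oppr_le0 divr_ge0 ?powR_ge0// ltW.
have [_ /itvN11_gt0[r1 r2]] := lr_itv n.
by rewrite ler_pM2r ?invr_gt0// powR2_ge//; lra.
Qed.

Lemma measurable_powR_comp (D : set R) (f : R -> R) (a : R) :
  @measurable_fun _ _ (measurableTypeR R) R D f ->
  @measurable_fun _ _ (measurableTypeR R) R D (fun x => f x `^ a).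
Proof. by move=> mf; exact: (measurableT_comp (@measurable_powR R a) mf). Qed.

(** Each factor is singular at one end only: on either side of 0 the other factor is bounded, so a
    multiple of the sum dominates the product. *)
Lemma integrable_jacobi_weight (a b : R) : -1 < a -> -1 < b ->
  mu.-integrable itv (EFin \o jacobi_weight a b).
Proof.
(* Powers [a + 1] and [b + 1] are increasing even for negative [a] or [b], and they dominate the
   original powers of a base at least 1. *)
move=> a1 b1; pose C : R := 2 `^ (a + 1) + 2 `^ (b + 1).
have ig : mu.-integrable itv
    (EFin \o (fun x => C * ((1 - x) `^ a + (1 + x) `^ b))).
  exact: (integrableZl _ C (integrableD _ (integrable_powR_1B a1) (integrable_powR_1D b1))).
apply: le_integrable ig => //.
  apply/measurable_EFinP; apply: measurable_funM; apply: measurable_powR_comp.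
    exact: measurable_funB.
  exact: measurable_funD.
move=> x /itvN11_gt0[x1 x2] /=; rewrite lee_fin.
have pa := powR_ge0 (1 - x) a; have pb := powR_ge0 (1 + x) b.
have qa : 0 <= 2 `^ (a + 1) :> R by exact: powR_ge0.
have qb : 0 <= 2 `^ (b + 1) :> R by exact: powR_ge0.
rewrite !ger0_norm ?mulr_ge0 ?addr_ge0// /jacobi_weight /C.
have [x0|x0] := leP 0 x.
  have : (1 + x) `^ b <= 2 `^ (b + 1).
    apply: (@le_trans _ _ ((1 + x) `^ (b + 1))).
      by rewrite ler_powR ?lerDl//.
    by apply: powR2_ge => //; lra.
  by nra.
have : (1 - x) `^ a <= 2 `^ (a + 1).
  apply: (@le_trans _ _ ((1 - x) `^ (a + 1))).
    by rewrite ler_powR ?lerDl// oppr_ge0 ltW.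
  by apply: powR2_ge => //; lra.
by nra.
Qed.

(** The difference of the two sides integrates the derivative of [jacobi_weight (a + 1) (b + 1)],
    which vanishes at both ends. This Beta recurrence trades a factor 1 + x for a factor 1 - x. *)
Lemma Rintegral_jacobi_weight_shift (a b : R) : -1 < a -> -1 < b ->
  (a + 1) * \int[mu]_(x in itv) jacobi_weight a (b + 1) x =
  (b + 1) * \int[mu]_(x in itv) jacobi_weight (a + 1) b x.
Proof.
move=> a1 b1.
have a0 : 0 < a + 1 by rewrite -ltrBlDr sub0r.
have b0 : 0 < b + 1 by rewrite -ltrBlDr sub0r.
have a2 : -1 < a + 1 by rewrite (lt_trans _ a0)// ltrN10.
have b2 : -1 < b + 1 by rewrite (lt_trans _ b0)// ltrN10.
have ia := integrable_jacobi_weight a1 b2.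
have ib := integrable_jacobi_weight a2 b1.
have iza : mu.-integrable itv (EFin \o (fun x => (a + 1) * jacobi_weight a (b + 1) x)).
  exact: (@integrableZl _ (measurableTypeR R) R lebesgue_measure itv _ _ _ ia).
have izb : mu.-integrable itv (EFin \o (fun x => (b + 1) * jacobi_weight (a + 1) b x)).
  exact: (@integrableZl _ (measurableTypeR R) R lebesgue_measure itv _ _ _ ib).
apply/esym/eqP; rewrite -subr_eq0 -!RintegralZl// -RintegralB//; apply/eqP.
apply: (@Rintegral_exhaustion _ _ l r _ (jacobi_weight (a + 1) (b + 1))
  l_lt_r l_ni r_nd bigcup_itvN11).
- move=> x /itvN11_gt0[x1 x2].
  have dp := is_derive_jacobi_weight (a + 1) (b + 1) x1 x2.
  by apply: is_derive_eq; rewrite !addrK.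
- move=> x /itvN11_gt0[x1 x2]; apply: derivable_continuous.
  have [d1 _] := is_derive_jacobi_weight (a + 1) b x1 x2.
  have [d2 _] := is_derive_jacobi_weight a (b + 1) x1 x2.
  apply: derivableB.
    by apply: derivableM; [exact: derivable_cst|exact: d1].
  by apply: derivableM; [exact: derivable_cst|exact: d2].
- exact: (@integrableB _ (measurableTypeR R) R lebesgue_measure itv _ _ _ izb iza).
have bound (c d x y : R) : 0 <= x -> 0 < y -> y <= 2 -> -1 < d ->
    0 <= x `^ c * y `^ (d + 1) <= x `^ c * 2 `^ (d + 1).
  move=> x0 y0 y2 d1; rewrite mulr_ge0 ?powR_ge0//=.
  by rewrite ler_wpM2l ?powR_ge0// powR2_ge.
have cvg0 (c d : R) : 0 < c -> (fun n => shrink n `^ c * 2 `^ (d + 1)) @ \oo --> (0 : R).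
  move=> c0; rewrite -[X in _ --> X](mul0r (2 `^ (d + 1))).
  by apply: cvgM; [exact: cvg_powR_shrink|exact: cvg_cst].
rewrite -[X in _ --> X](subr0 0); apply: cvgB.
- apply: (@squeeze_cvgr _ _ _ _ (cst 0) (fun n => shrink n `^ (a + 1) * 2 `^ (b + 1))).
  + near=> n; have [_ /itvN11_gt0[r1 r2]] := lr_itv n.
    have s0 := @shrink_gt0 R n.
    rewrite /jacobi_weight (_ : 1 - r n = shrink n); last by rewrite /r; ring.
    by apply: bound; rewrite ?ltW//; lra.
  + exact: cvg_cst.
  + exact: cvg0.
- apply: (@squeeze_cvgr _ _ _ _ (cst 0) (fun n => shrink n `^ (b + 1) * 2 `^ (a + 1))).
  + near=> n; have [/itvN11_gt0[l1 l2] _] := lr_itv n.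
    have s0 := @shrink_gt0 R n.
    rewrite /jacobi_weight mulrC (_ : 1 + l n = shrink n); last by rewrite /l; ring.
    by apply: bound; rewrite ?ltW//; lra.
  + exact: cvg_cst.
  + exact: cvg0.
Unshelve. all: by end_near. Qed.

End JacobiWeight.

(** * Moments and orthogonality for Jacobi *)

Section JacobiOrthogonality.
Context {R : realType}.
Notation mu := (@lebesgue_measure R).
Notation itv := (`](-1)%R, 1%R[%classic : set R).
Variables a b : R.
Hypotheses (a1 : -1 < a) (b1 : -1 < b).

Let as1 s : -1 < a + s%:R.
Proof. by rewrite (lt_le_trans a1)// lerDl. Qed.

Let bs1 s : -1 < b + s%:R.
Proof. by rewrite (lt_le_trans b1)// lerDl. Qed.

Let K (s r : nat) :=
  \int[mu]_(x in itv) jacobi_weight (a + s%:R) (b + r%:R) x.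

Let K_shift s r : (a + s%:R + 1) * K s r.+1 = (b + r%:R + 1) * K s.+1 r.
Proof.
have := Rintegral_jacobi_weight_shift (as1 s) (bs1 r).
by rewrite -(addrA b) natr1 -(addrA a) natr1.
Qed.

Let jacobi_weight_shift s r x : itv x ->
  jacobi_weight (a + s%:R) (b + r%:R) x =
  jacobi_weight a b x * (1 - x) ^+ s * (1 + x) ^+ r.
Proof.
move=> /itvN11_gt0[x1 x2]; rewrite /jacobi_weight.
rewrite !powRD; [|by rewrite (gt_eqF x2) implybT|by rewrite (gt_eqF x1) implybT].
by rewrite !powR_mulrn ?ltW//; ring.
Qed.

(** The [s]-th summand of [jacobi_moment] stripped of its sign, factorials and power of 2. *)
Let T n j s := (\prod_(k < n - s) (n%:R + a - k%:R)) *
  (\prod_(k < s) (n%:R + b - k%:R)) * K s (n - s + j).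

(** Passing from [s] to [s + 1] multiplies [T] by a ratio x / (x + j), and these ratios telescope.
    In cross-multiplied form the dependence on [s] is visibly polynomial of degree [j]. *)
Let T_rec n j s : (s <= n)%N ->
  T n j s * \prod_(k < j) (n%:R + b + 1 + k%:R) =
  (\prod_(k < j) (- s%:R + (n%:R + b + 1 + k%:R))) * T n j 0.
Proof.
elim: s => [_|s IHs sn].
  by rewrite mulrC; congr (_ * _); apply: eq_bigr => k _; rewrite oppr0 add0r.
have {}IHs := IHs (ltnW sn).
pose m := (n - s.+1)%N; have nE : n = (m + s.+1)%N by rewrite subnK.
have nsE : (n - s = m.+1)%N by rewrite nE addnS -addSn addnK.
have nR : n%:R = m%:R + s%:R + 1 :> R by rewrite nE natrD -natr1 addrA.
(* This is n - s + b, the new factor of the second binomial at [s + 1]. *)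
pose x : R := m%:R + 1 + b.
have xj0 : x + j%:R != 0.
  have b2 : 0 < 1 + b by rewrite -ltrBlDl sub0r.
  by rewrite gt_eqF// ltr_wpDr ?ler0n// /x -addrA ltr_wpDl ?ler0n.
apply: (mulfI xj0).
(* The first binomial loses the factor a + s + 1 and the second gains [x]; [K_shift] exchanges a + s
   + 1 for x + j. *)
have TS : (x + j%:R) * T n j s.+1 = x * T n j s.
  move: (K_shift s (m + j)).
  rewrite /T nsE -/m addSn => KS; rewrite [in LHS]big_ord_recr [in RHS]big_ord_recr/=.
  transitivity (x * ((\prod_(k < m) (n%:R + a - k%:R)) *
     (\prod_(k < s) (n%:R + b - k%:R)) * ((b + (m + j)%:R + 1) * K s.+1 (m + j)))).
    by rewrite nR natrD /x; ring.
  by rewrite -KS nR /x; ring.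
have PS : (x + j%:R) * (\prod_(k < j) (- s.+1%:R + (n%:R + b + 1 + k%:R))) =
    x * (\prod_(k < j) (- s%:R + (n%:R + b + 1 + k%:R))).
  transitivity (\prod_(k < j.+1) (x + k%:R)).
    rewrite big_ord_recr/= mulrC; congr (_ * _); apply: eq_bigr => k _.
    by rewrite nR -natr1 /x; ring.
  rewrite big_ord_recl/= addr0; congr (_ * _); apply: eq_bigr => k _.
  by rewrite nR /x /bump/= natrD; ring.
by rewrite mulrA TS -mulrA IHs !mulrA PS.
Qed.

Let jacobi_moment n j : (j < n)%N ->
  \sum_(s < n.+1) gbinom (n%:R + a) (n - s) * gbinom (n%:R + b) s / 2 ^+ n *
    (-1) ^+ s * K s (n - s + j) = 0.
Proof.
move=> jn.
have [P0 sP0 P0E] := prod_shift_poly (fun k => n%:R + b + 1 + k%:R) j.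
(* The variable enters [T_rec] with a minus sign; the substitution keeps the degree [j]. *)
pose P : {poly R} := P0 \Po (- 'X).
have sX : size (- 'X : {poly R}) = 2 by rewrite size_polyN size_polyX.
have := @alternating_binomial_sum R n P; rewrite (size_comp_poly2 _ sX) sP0 => /(_ jn) H0.
pose C : R := \prod_(k < j) (n%:R + b + 1 + k%:R).
have C0 : C != 0.
  rewrite gt_eqF// prodr_gt0// => k _.
  by rewrite ltr_wpDr ?ler0n// -addrA ltr_wpDl ?ler0n// -ltrBlDr sub0r.
have n0 : n`!%:R != 0 :> R by rewrite pnatr_eq0 -lt0n fact_gt0.
transitivity (T n j 0 / C / n`!%:R / 2 ^+ n *
    \sum_(s < n.+1) (-1) ^+ s * 'C(n, s)%:R * P.[s%:R]); last by rewrite H0 mulr0.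
rewrite mulr_sumr; apply: eq_bigr => s _.
have sn : (s <= n)%N by rewrite -ltnS.
transitivity ((-1) ^+ s * T n j s / 2 ^+ n * (((n - s)`!%:R)^-1 * (s`!%:R)^-1)).
  by rewrite /gbinom /T; ring.
have TE : T n j s = P.[s%:R] * T n j 0 / C.
  by rewrite horner_comp hornerN hornerX P0E -T_rec// mulfK.
by rewrite bin_invfact// TE; ring.
Qed.

Lemma integrable_jacobi_poly (q : {poly R}) :
  mu.-integrable itv (EFin \o (fun x => jacobi_weight a b x * q.[x])).
Proof.
pose c := q \Po ('X - 1).
have := @integrable_lincomb _ itv 'I_(size c) (fun i => c`_i)
  (fun i => jacobi_weight (a + 0%:R) (b + i%:R)) _ _ (index_enum _).
move=> /(_ _ _)/eq_integrable; apply => //; last first.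
  by move=> i; exact: integrable_jacobi_weight.
move=> x /set_mem xitv; congr EFin.
rewrite (_ : q.[x] = c.[1 + x]); last first.
  by rewrite /c horner_comp !hornerE addrAC subrr add0r.
rewrite horner_coef mulr_sumr; apply: eq_bigr => i _.
by rewrite jacobi_weight_shift// expr0; ring.
Qed.

Lemma jacobi_orth n (q : {poly R}) : (size q <= n)%N ->
  \int[mu]_(x in itv) (jacobi_weight a b x * (jacobi a b n * q).[x]) = 0.
Proof.
(* The coefficients of [c] are those of [q] in powers of 1 + x. In this basis every product with a
   Jacobi summand is again a Jacobi weight with shifted exponents, up to the sign that turns x - 1
   into 1 - x. *)
move=> sq; pose c := q \Po ('X - 1).
have sc : (size c <= n)%N.
  by rewrite size_comp_poly2// -polyC1 size_XsubC.
pose g (s : 'I_n.+1) := gbinom (n%:R + a) (n - s) * gbinom (n%:R + b) s / 2 ^+ n * (-1) ^+ s.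
pose f (j : 'I_n) x := \sum_(s < n.+1) g s *
  jacobi_weight (a + s%:R) (b + (n - s + j)%:R) x.
have fi (j : 'I_n) (s : 'I_n.+1) :
    mu.-integrable itv (EFin \o jacobi_weight (a + s%:R) (b + (n - s + j)%:R)).
  exact: integrable_jacobi_weight.
transitivity (\int[mu]_(x in itv) \sum_(j < n) c`_j * f j x).
  apply: eq_Rintegral => x /set_mem xitv.
  rewrite hornerM (_ : q.[x] = c.[1 + x]); last first.
    by rewrite /c horner_comp !hornerE addrAC subrr add0r.
  rewrite (horner_coef_wide _ sc) mulr_sumr mulr_sumr; apply: eq_bigr => j _.
  rewrite mulrA /jacobi horner_sum mulr_sumr mulr_suml /f mulr_sumr.
  apply: eq_bigr => s _; rewrite jacobi_weight_shift// exprD /g.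
  have xE : (x - 1) ^+ s = (-1) ^+ s * (1 - x) ^+ s by rewrite -exprMn mulN1r opprB.
  by rewrite hornerZ !hornerE/= xE (addrC x 1) /jacobi_weight; ring.
rewrite Rintegral_lincomb//; last by move=> j; exact: integrable_lincomb.
rewrite big1// => j _; rewrite Rintegral_lincomb//.
by rewrite jacobi_moment ?mulr0.
Qed.

End JacobiOrthogonality.

(** * The three families as exponential weights *)

Lemma powR_expR_ln (R : realType) (x t : R) : 0 < x -> x `^ t = expR (t * ln x).
Proof. by move=> x0; rewrite /powR gt_eqF. Qed.

Lemma eq_weighted_integral (R : realType) (D : set R) (w0 L : R -> R) (t : R)
    (w : R -> R) :
  @measurable _ (measurableTypeR R) D ->
  (forall x, D x -> w0 x * expR (t * L x) = w x) ->
  (forall q : {poly R}, lebesgue_measure.-integrable D (EFin \o (fun x => w x * q.[x])) ->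
     lebesgue_measure.-integrable D (EFin \o weighted w0 L 0 t q)) /\
  (forall q : {poly R}, wint D w0 L 0 t q =
     \int[lebesgue_measure]_(x in D) (w x * q.[x])).
Proof.
move=> mD wE; have qE q x : x \in D -> weighted w0 L 0 t q x = w x * q.[x].
  by move=> /set_mem Dx; rewrite /weighted expr0 mul1r wE.
split=> q; last by apply: eq_Rintegral => x Dx; exact: qE.
by apply: eq_integrable => // x Dx /=; rewrite qE.
Qed.

Theorem theorem1 (R : realType) (F : param_family R) (hF : classical_family F)
    (n : nat) :
  (forall m t, param F t -> 0 < wnorm F m t) /\
  (exists A : nat -> R -> R, param_derive_expansion F (stdpoly F) n A) /\
  (exists At : nat -> R -> R, param_derive_expansion F (orthopoly F) n At) /\
  (forall A At : nat -> R -> R,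
     param_derive_expansion F (stdpoly F) n A ->
     param_derive_expansion F (orthopoly F) n At ->
     forall t, param F t ->
       (forall k, (k < n)%N -> At k t = wnorm F k t / wnorm F n t * A k t) /\
       derivable (wnorm F n) t 1 /\
       At n t = A n t - (wnorm F n t)^-1 * derive1 (wnorm F n) t /\
       derivable (At n) t 1 /\
       (forall x, supp_itv F x ->
          derivable (fun s => root_density F n s x) t 1) /\
       fisher_information F n t =
         (2 * (\sum_(k < n) (At k t) ^+ 2) - 2 * derive1 (At n) t)%:E).
Proof.
have muD : (0 < lebesgue_measure (`](-1)%R, 1%R[%classic : set R))%E.
  have N11 : -1 < 1 :> R by lra.
  by rewrite lebesgue_measure_itv/= lte_fin N11 -EFinB lte_fin subr_gt0.
have m1B : @measurable_fun _ _ (measurableTypeR R) R `](-1)%R, 1%R[ (fun x => 1 - x).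
  exact: measurable_funB.
have m1D : @measurable_fun _ _ (measurableTypeR R) R `](-1)%R, 1%R[ (fun x => 1 + x).
  exact: measurable_funD.
have mln := @measurable_ln R.
case: hF => [|b b1|a a1].
- have pos0 x : (`]0%R, +oo[%classic : set R) x -> 0 < x by rewrite /= in_itv/= andbT.
  have mD : @measurable _ (measurableTypeR R) (`]0%R, +oo[%classic : set R) by [].
  have W (t : R) := @eq_weighted_integral R _ (fun x => expR (- x)) (@ln R) t
    (laguerre_weight t) mD.
  have wE (t x : R) : (`]0%R, +oo[%classic : set R) x ->
      expR (- x) * expR (t * ln x) = laguerre_weight t x.
    by move=> /pos0 x0; rewrite /laguerre_weight powR_expR_ln.
  apply: (@exponential_weight_fisher R _ (fun x => expR (- x)) (@ln R) mD).
  + by apply: (measurableT_comp (@measurable_expR R)); exact: measurable_funN.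
  + exact: measurable_funTS.
  + move=> t q t1; apply: (W t (wE t)).1; exact: integrable_laguerre_poly.
  + by move=> x _; exact: expR_gt0.
  + by rewrite lebesgue_measure_itv/= ltry addye ?ltry.
  + by [].
  + by [].
  + by move=> t x Dx /=; rewrite wE.
  + by move=> t m; exact: size_laguerre.
  + by move=> t m _; exact: laguerre_neq0.
  + by move=> t m i; exact: derivable_coef_laguerre.
  + by move=> t m q t1 sq; rewrite (W t (wE t)).2; exact: laguerre_orth.
- have mD : @measurable _ (measurableTypeR R) (`](-1)%R, 1%R[%classic : set R) by [].
  have W (t : R) := @eq_weighted_integral R _ (fun x => (1 + x) `^ b)
    (fun x => ln (1 - x)) t (jacobi_weight t b) mD.
  have wE (t x : R) : (`](-1)%R, 1%R[%classic : set R) x ->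
      (1 + x) `^ b * expR (t * ln (1 - x)) = jacobi_weight t b x.
    by move=> /itvN11_gt0[x1 _]; rewrite /jacobi_weight (powR_expR_ln t x1) mulrC.
  apply: (@exponential_weight_fisher R _ (fun x => (1 + x) `^ b)
    (fun x => ln (1 - x)) mD).
  + exact: measurable_powR_comp.
  + exact: (measurableT_comp mln).
  + move=> t q t1; apply: (W t (wE t)).1; exact: integrable_jacobi_poly.
  + by move=> x /itvN11_gt0[_ x1]; exact: powR_gt0.
  + exact: muD.
  + by [].
  + by [].
  + by move=> t x Dx /=; rewrite wE.
  + by move=> t m; exact: size_jacobi.
  + by move=> t m t1; exact: jacobi_neq0.
  + move=> t m i; apply: (@derivable_coef_jacobi _ id (cst b)) => k.
      exact: derivable_gbinom.
    exact: (derivable_cst (gbinom (m%:R + b) k)).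
  + by move=> t m q t1 sq; rewrite (W t (wE t)).2; exact: jacobi_orth.
- have mD : @measurable _ (measurableTypeR R) (`](-1)%R, 1%R[%classic : set R) by [].
  have W (t : R) := @eq_weighted_integral R _ (fun x => (1 - x) `^ a)
    (fun x => ln (1 + x)) t (jacobi_weight a t) mD.
  have wE (t x : R) : (`](-1)%R, 1%R[%classic : set R) x ->
      (1 - x) `^ a * expR (t * ln (1 + x)) = jacobi_weight a t x.
    by move=> /itvN11_gt0[_ x2]; rewrite /jacobi_weight (powR_expR_ln t x2).
  apply: (@exponential_weight_fisher R _ (fun x => (1 - x) `^ a)
    (fun x => ln (1 + x)) mD).
  + exact: measurable_powR_comp.
  + exact: (measurableT_comp mln).
  + move=> t q t1; apply: (W t (wE t)).1; exact: integrable_jacobi_poly.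
  + by move=> x /itvN11_gt0[x1 _]; exact: powR_gt0.
  + exact: muD.
  + by [].
  + by [].
  + by move=> t x Dx /=; rewrite wE.
  + by move=> t m; exact: size_jacobi.
  + by move=> t m _; exact: jacobi_neq0.
  + move=> t m i; apply: (@derivable_coef_jacobi _ (cst a) id) => k.
      exact: (derivable_cst (gbinom (m%:R + a) k)).
    exact: derivable_gbinom.
  + by move=> t m q t1 sq; rewrite (W t (wE t)).2; exact: jacobi_orth.
Qed.
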